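(* Let $\mathbf H$ be a commutative and cocommutative connected Hopf monoid linearized in the basis $\mathbf h$, $I$ a finite set, and $x,y\in\mathbf h[I]$ with $\mathcal C_x^y\ne\emptyset$. Let $c_x^y=\sum_{A\in\mathcal C_x^y}(-1)^{\ell(A)}$ be the coefficient of $y$ in the antipode $S_I(x)$ of $\mathbf H$. Then $$c_x^y=c_{x/y}^{\epsilon},$$ where $x/y=G_x^y$ is the hypergraph on $[m]$ defined below, $\epsilon$ is the hypergraph on $[m]$ with no edges, and $c_{x/y}^\epsilon$ denotes the coefficient of $\epsilon$ in the antipode $S_{[m]}(G_x^y)$ computed in the Hopf monoid of hypergraphs $\mathbf{HG}$.
   Context: Work over a field of characteristic $0$. A connected Hopf monoid in vector species $\mathbf H$ has products $\mu_{A_1,A_2}$ and coproducts $\Delta_{A_1,A_2}$ for ordered decompositions $I=A_1\sqcup A_2$, satisfying associativity, coassociativity and compatibility axioms; commutative and cocommutative mean $\mu$ and $\Delta$ are invariant under swapping the two factors. It is linearized in the basis $\mathbf h$ if products send basis pairs to basis elements and coproducts send basis elements to $0$ or to a tensor of basis elements. A set composition $A=(A_1,\dots,A_k)\models I$ is a sequence of nonempty disjoint subsets with union $I$, $\ell(A)=k$; $\mu_A,\Delta_A$ are iterated product/coproduct, and the antipode is $S_I=\sum_{A\models I}(-1)^{\ell(A)}\mu_A\Delta_A$. For $x\in\mathbf h[I]$ with $\Delta_A(x)\ne0$ put $x_A=\mu_A\Delta_A(x)$; $\mathcal C_x^y=\{A\models I:\Delta_A(x)\ne0,\ x_A=y\}$.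 $A\le B$ if every part of $B$ is a union of consecutive parts of $A$. Fix a minimal element $\Lambda=(\Lambda_1,\dots,\Lambda_m)$ of $\mathcal C_x^y$. For $P\subseteq I$ a union of parts of $\Lambda$, write $\Delta_{P,I\setminus P}(x)=x_P\otimes x_{I\setminus P}$ with $x_P\in\mathbf h[P]$. The hypergraph $G_x^y$ on vertex set $[m]$ has as hyperedges exactly the subsets $U\subseteq[m]$ such that $\prod_{i\in U}x_{\Lambda_i}\ne x_{\bigcup_{i\in U}\Lambda_i}$ while $\prod_{i\in P}x_{\Lambda_i}=x_{\bigcup_{i\in P}\Lambda_i}$ for every nonempty proper subset $P\subsetneq U$ (products taken with $\mu$; by commutativity order is irrelevant); it is independent of the choice of $\Lambda$ up to relabelling of $[m]$. The Hopf monoid $\mathbf{HG}$: $\mathbf{HG}[J]$ has basis the hypergraphs on $J$, i.e. sets $h$ of subsets of $J$ each of size at least $2$; $\mu_{P,T}(h,k)=h\cup k$ and $\Delta_{P,T}(h)=h|_P\otimes h|_T$ with $h|_P=\{U\in h:U\subseteq P\}$. *)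

(* Defs.v *)
From HB Require Import structures.
From mathcomp Require Import all_boot all_order all_algebra.
From mathcomp Require Import finmap.
From mathcomp.multinomials Require Import monalg.

Set Implicit Arguments.
Unset Strict Implicit.
Unset Printing Implicit Defensive.

Import GRing.Theory.
Local Open Scope ring_scope.

(** [{malg K[S]}] is the vector space with basis [S], and [<< s >>] is the basis
    vector of [s].  The tensor product of [{malg K[S]}] and [{malg K[R]}] is
    [{malg K[S * R]}], in which [<< (s, r) >>] is the tensor of [<< s >>] and
    [<< r >>]. *)

Section FreeModules.
Variable K : fieldType.

Definition lext (S : choiceType) (V : lmodType K) (phi : S -> V)
    (v : {malg K[S]}) : V :=
  \sum_(s <- msupp v) v@_s *: phi s.

Lemma lextEw (S : choiceType) (V : lmodType K) (phi : S -> V)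
    (d : {fset S}) (v : {malg K[S]}) :
  (msupp v `<=` d)%fset -> lext phi v = \sum_(s <- d) v@_s *: phi s.
Proof.
move=> le_vd; rewrite /lext (big_fset_incl _ le_vd) // => s _ /mcoeff_outdom ->.
by rewrite scale0r.
Qed.

Lemma lext_is_linear (S : choiceType) (V : lmodType K) (phi : S -> V) :
  linear (lext phi).
Proof.
move=> c u v; pose d := (msupp u `|` msupp v)%fset.
have ud : (msupp u `<=` d)%fset by exact: fsubsetUl.
have vd : (msupp v `<=` d)%fset by exact: fsubsetUr.
have cuvd : (msupp (c *: u + v) `<=` d)%fset.
  apply: fsubset_trans (msuppD_le _ _) _.
  by rewrite fsubUset vd andbT (fsubset_trans (msuppZ_le _ _)).
rewrite (lextEw _ ud) (lextEw _ vd) (lextEw _ cuvd) scaler_sumr -big_split /=.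
by apply: eq_bigr => s _; rewrite mcoeffD mcoeffZ scalerDl scalerA.
Qed.

HB.instance Definition _ (S : choiceType) (V : lmodType K) (phi : S -> V) :=
  GRing.isLinear.Build K {malg K[S]} V _ (lext phi) (lext_is_linear phi).

Lemma lextU (S : choiceType) (V : lmodType K) (phi : S -> V) (s : S) :
  lext phi << s >> = phi s.
Proof. by rewrite /lext msuppU oner_eq0 big_seq_fset1 mcoeffUU scale1r. Qed.

Lemma lext_unique (S : choiceType) (V : lmodType K)
    (f : {linear {malg K[S]} -> V}) : lext (fun s => f << s >>) =1 f.
Proof.
move=> v; rewrite {2}[v]monalgE linear_sum; apply: eq_bigr => s _.
rewrite -linearZ; congr (f _); apply/malgP => k.
by rewrite mcoeffZ !mcoeffU mulrnAr mulr1.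
Qed.

Lemma malg_ext (S : choiceType) (V : lmodType K)
    (f g : {linear {malg K[S]} -> V}) :
  (forall s, f << s >> = g << s >>) -> f =1 g.
Proof.
move=> fg v; rewrite -(lext_unique f) -(lext_unique g).
by apply: eq_bigr => s _; rewrite fg.
Qed.

Definition lmap (S R : choiceType) (phi : S -> R) :
    {linear {malg K[S]} -> {malg K[R]}} :=
  lext (fun s => << phi s >> : {malg K[R]}).

Definition tens (S R : choiceType) (u : {malg K[S]}) (v : {malg K[R]}) :
    {malg K[(S * R)%type]} :=
  lext (fun s => lext (fun r => << (s, r) >> : {malg K[(S * R)%type]}) v) u.

Definition tmap (S R S' R' : choiceType)
    (f : {malg K[S]} -> {malg K[S']}) (g : {malg K[R]} -> {malg K[R']}) :
    {linear {malg K[(S * R)%type]} -> {malg K[(S' * R')%type]}} :=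
  lext (fun p => tens (f << p.1 >>) (g << p.2 >>)).

Definition tswap (S R : choiceType) :
    {linear {malg K[(S * R)%type]} -> {malg K[(R * S)%type]}} :=
  lmap (fun p => (p.2, p.1)).

Definition tassoc (S R Q : choiceType) :
    {linear {malg K[((S * R) * Q)%type]} -> {malg K[(S * (R * Q))%type]}} :=
  lmap (fun p => (p.1.1, (p.1.2, p.2))).

Definition tmid (S R S' R' : choiceType) :
    {linear {malg K[((S * R) * (S' * R'))%type]} -> {malg K[((S * S') * (R * R'))%type]}} :=
  lmap (fun p => ((p.1.1, p.2.1), (p.1.2, p.2.2))).

End FreeModules.

Arguments lmap {K S R} phi.
Arguments tswap {K S R}.
Arguments tassoc {K S R Q}.
Arguments tmid {K S R S' R'}.

(** A finite set is a subset [A] of a finite type [T]; a decomposition of [I] is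
    a pair of subsets of the same ambient type. *)

Definition elt (T : finType) (A : {set T}) : finType := {x : T | x \in A}.

Definition restricts (T T' : finType) (I A : {set T}) (J C : {set T'})
    (f : elt I -> elt J) (g : elt A -> elt C) : Prop :=
  forall (i : elt I) (a : elt A), val i = val a -> val (f i) = val (g a).

Definition decomp (T : finType) (I A B : {set T}) : bool :=
  (A :|: B == I) && [disjoint A & B].

(** Underlying data of a Hopf monoid on a vector species with a chosen basis.
    [relabel f], [mul I A B] and [comul I A B] are meaningful, and subject to
    axioms, only when [f] is bijective, respectively when [decomp I A B] holds.
    [hunit I] is the image of 1 under the component at [I] of the morphism
    1 -> H, and [hcounit I] is the component of H -> 1, where the species 1 is K
    on the empty set and 0 elsewhere. *)
Record hopf_data (K : fieldType) := HopfData {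
  basis : forall T : finType, {set T} -> choiceType;
  relabel : forall (T T' : finType) (A : {set T}) (B : {set T'}),
    (elt A -> elt B) -> {linear {malg K[basis A]} -> {malg K[basis B]}};
  hunit : forall (T : finType) (I : {set T}), {malg K[basis I]};
  hcounit : forall (T : finType) (I : {set T}),
    {linear {malg K[basis I]} -> K^o};
  mul : forall (T : finType) (I A B : {set T}),
    {linear {malg K[(basis A * basis B)%type]} -> {malg K[basis I]}};
  comul : forall (T : finType) (I A B : {set T}),
    {linear {malg K[basis I]} -> {malg K[(basis A * basis B)%type]}}
}.

Arguments basis {K} h {T} A.
Arguments relabel {K} h {T T' A B} f.
Arguments hunit {K} h {T} I.
Arguments hcounit {K} h {T} I.
Arguments mul {K} h {T} I A B.
Arguments comul {K} h {T} I A B.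

Local Notation "H @[ A ]" := {malg _[basis H A]}
  (at level 2, left associativity, A at level 99, format "H @[ A ]").

Section HopfMonoid.
Variables (K : fieldType) (H : hopf_data K).

Record is_species : Prop := IsSpecies {
  relabel_id : forall (T : finType) (A : {set T}) (v : H@[A]),
    relabel H (@id (elt A)) v = v;
  relabel_comp : forall (T1 T2 T3 : finType)
      (A : {set T1}) (B : {set T2}) (C : {set T3})
      (f : elt A -> elt B) (g : elt B -> elt C) (v : H@[A]),
    bijective f -> bijective g ->
    relabel H (g \o f) v = relabel H g (relabel H f v)
}.

Record is_natural : Prop := IsNatural {
  unit_nat : forall (T T' : finType) (I : {set T}) (J : {set T'})
      (f : elt I -> elt J),
    bijective f -> relabel H f (hunit H I) = hunit H J;
  counit_nat : forall (T T' : finType) (I : {set T}) (J : {set T'})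
      (f : elt I -> elt J) (v : H@[I]),
    bijective f -> hcounit H J (relabel H f v) = hcounit H I v;
  mul_nat : forall (T T' : finType) (I A B : {set T}) (J C D : {set T'})
      (f : elt I -> elt J) (g : elt A -> elt C) (k : elt B -> elt D)
      (t : {malg K[(basis H A * basis H B)%type]}),
    decomp I A B -> decomp J C D ->
    bijective f -> bijective g -> bijective k ->
    restricts f g -> restricts f k ->
    relabel H f (mul H I A B t)
      = mul H J C D (tmap (relabel H g) (relabel H k) t);
  comul_nat : forall (T T' : finType) (I A B : {set T}) (J C D : {set T'})
      (f : elt I -> elt J) (g : elt A -> elt C) (k : elt B -> elt D)
      (v : H@[I]),
    decomp I A B -> decomp J C D ->
    bijective f -> bijective g -> bijective k ->
    restricts f g -> restricts f k ->
    comul H J C D (relabel H f v)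
      = tmap (relabel H g) (relabel H k) (comul H I A B v)
}.

Record is_monoid : Prop := IsMonoid {
  unit_eq0 : forall (T : finType) (I : {set T}), I != set0 -> hunit H I = 0;
  mul_1l : forall (T : finType) (I : {set T}) (v : H@[I]),
    mul H I set0 I (tens (hunit H set0) v) = v;
  mul_1r : forall (T : finType) (I : {set T}) (v : H@[I]),
    mul H I I set0 (tens v (hunit H set0)) = v;
  mul_assoc : forall (T : finType) (I A B C : {set T})
      (t : {malg K[((basis H A * basis H B) * basis H C)%type]}),
    decomp (A :|: B) A B -> decomp I (A :|: B) C ->
    mul H I (A :|: B) C (tmap (mul H (A :|: B) A B) idfun t)
      = mul H I A (B :|: C) (tmap idfun (mul H (B :|: C) B C) (tassoc t))
}.

Record is_comonoid : Prop := IsComonoid {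
  counit_eq0 : forall (T : finType) (I : {set T}) (v : H@[I]),
    I != set0 -> hcounit H I v = 0;
  comul_1l : forall (T : finType) (I : {set T}) (v : H@[I]),
    lext (fun p => hcounit H set0 << p.1 >> *: (<< p.2 >> : H@[I]))
         (comul H I set0 I v) = v;
  comul_1r : forall (T : finType) (I : {set T}) (v : H@[I]),
    lext (fun p => hcounit H set0 << p.2 >> *: (<< p.1 >> : H@[I]))
         (comul H I I set0 v) = v;
  comul_assoc : forall (T : finType) (I A B C : {set T}) (v : H@[I]),
    decomp (A :|: B) A B -> decomp I (A :|: B) C ->
    tassoc (tmap (comul H (A :|: B) A B) idfun (comul H I (A :|: B) C v))
      = tmap idfun (comul H (B :|: C) B C) (comul H I A (B :|: C) v)
}.

Record is_compatible : Prop := IsCompatible {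
  counit_unit : forall T : finType, hcounit H (@set0 T) (hunit H set0) = 1;
  comul_unit : forall T : finType,
    comul H (@set0 T) set0 set0 (hunit H set0) = tens (hunit H set0) (hunit H set0);
  counit_mul : forall (T : finType) (u v : H@[@set0 T]),
    hcounit H set0 (mul H set0 set0 set0 (tens u v))
      = hcounit H set0 u * hcounit H set0 v;
  comul_mul : forall (T : finType) (I A B C D : {set T})
      (t : {malg K[(basis H A * basis H B)%type]}),
    decomp I A B -> decomp I C D ->
    comul H I C D (mul H I A B t)
      = tmap (mul H C (A :&: C) (B :&: C)) (mul H D (A :&: D) (B :&: D))
          (tmid (tmap (comul H A (A :&: C) (A :&: D))
                      (comul H B (B :&: C) (B :&: D)) t))
}.

Definition is_connected : Prop :=
  forall (T : finType) (v : H@[@set0 T]), v = hcounit H set0 v *: hunit H set0.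

(* A connected bimonoid has an antipode, hence is a Hopf monoid. *)
Record connected_hopf_monoid : Prop := ConnectedHopfMonoid {
  chm_species : is_species;
  chm_natural : is_natural;
  chm_monoid : is_monoid;
  chm_comonoid : is_comonoid;
  chm_compatible : is_compatible;
  chm_connected : is_connected
}.

Definition commutative_monoid : Prop :=
  forall (T : finType) (I A B : {set T}) (t : {malg K[(basis H A * basis H B)%type]}),
    decomp I A B -> mul H I B A (tswap t) = mul H I A B t.

Definition cocommutative_comonoid : Prop :=
  forall (T : finType) (I A B : {set T}) (v : H@[I]),
    decomp I A B -> tswap (comul H I A B v) = comul H I B A v.

Definition linearized : Prop :=
  (forall (T : finType) (I A B : {set T}) (a : basis H A) (b : basis H B),
     decomp I A B -> exists c : basis H I, mul H I A B << (a, b) >> = << c >>)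
  /\
  (forall (T : finType) (I A B : {set T}) (x : basis H I),
     decomp I A B ->
     comul H I A B << x >> = 0 \/
     exists (a : basis H A) (b : basis H B), comul H I A B << x >> = << (a, b) >>).

End HopfMonoid.

Section Antipode.
Variables (K : fieldType) (H : hopf_data K) (T : finType).
Implicit Types (I P U : {set T}) (s : seq {set T}).

Definition set_comp I s : bool :=
  [&& all (fun P => P != set0) s,
      pairwise (fun P Q : {set T} => [disjoint P & Q]) s
    & \bigcup_(P <- s) P == I].

Fixpoint tbasis s : choiceType :=
  if s is P :: s' then (basis H P * tbasis s')%type else unit.

Fixpoint mul_seq s I : {malg K[tbasis s]} -> H@[I] :=
  match s with
  | [::] => fun t => t@_tt *: hunit H I
  | P :: s' => fun t => mul H I P (I :\: P) (tmap idfun (@mul_seq s' (I :\: P)) t)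
  end.

Fixpoint comul_seq s I : H@[I] -> {malg K[tbasis s]} :=
  match s with
  | [::] => fun v => hcounit H I v *: << tt >>
  | P :: s' => fun v => tmap idfun (@comul_seq s' (I :\: P)) (comul H I P (I :\: P) v)
  end.

(* A set composition of [I] has at most [#|I|] parts. *)
Definition antipode I (v : H@[I]) : H@[I] :=
  \sum_(k < #|I|.+1) \sum_(A : k.-tuple {set T} | set_comp I A)
     (-1) ^+ k *: mul_seq I (comul_seq A v).

Definition in_C I (x y : basis H I) s : bool :=
  [&& set_comp I s, comul_seq s (<< x >> : H@[I]) != 0
    & mul_seq I (comul_seq s (<< x >> : H@[I])) == << y >>].

Definition c_coef I (x y : basis H I) : K :=
  \sum_(k < #|I|.+1) \sum_(A : k.-tuple {set T} | in_C x y A) (-1) ^+ k.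

(* [refines A B] is A <= B: the parts of [B] are, in order, the unions of
   consecutive blocks of parts of [A]. *)
Definition refines (A B : seq {set T}) : Prop :=
  exists ss : seq (seq {set T}),
    A = flatten ss /\ B = [seq \bigcup_(P <- s) P | s <- ss].

Definition minimal_in_C I (x y : basis H I) s : Prop :=
  in_C x y s /\ forall s', in_C x y s' -> refines s' s -> s' = s.

(* If the coproduct of [x] along (P, I \ P) is the tensor of basis elements
   [<< (a, b) >>], then [restr x P] is [<< a >>]. *)
Definition restr I (x : basis H I) P : H@[P] :=
  lmap (fun p => p.1) (comul H I P (I :\: P) << x >>).

Fixpoint tens_seq (f : forall P, H@[P]) s : {malg K[tbasis s]} :=
  if s is P :: s' then tens (f P) (tens_seq f s') else << tt >>.

Section Hyperedges.
Variables (I : {set T}) (x : basis H I) (m : nat) (L : m.-tuple {set T}).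

Definition union_of (U : {set 'I_m}) : {set T} := \bigcup_(i in U) tnth L i.

Definition prod_eq_restr (U : {set 'I_m}) : bool :=
  mul_seq (union_of U) (tens_seq (restr x) [seq tnth L i | i <- enum U])
    == restr x (union_of U).

Definition is_hyperedge (U : {set 'I_m}) : Prop :=
  ~~ prod_eq_restr U /\
  forall P : {set 'I_m}, P != set0 -> P \proper U -> prod_eq_restr P.

End Hyperedges.

End Antipode.

Section Hypergraphs.
Variable K : fieldType.

Definition hypergraph_on (T : finType) (J : {set T}) (h : {set {set T}}) : bool :=
  [forall U in h, (1 < #|U|)%N && (U \subset J)].

Definition hypergraph (T : finType) (J : {set T}) : finType :=
  {h : {set {set T}} | hypergraph_on J h}.

Lemma hg_restr_subproof (T : finType) (J P : {set T}) (h : hypergraph J) :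
  hypergraph_on P [set U in val h | U \subset P].
Proof.
apply/forall_inP => U; rewrite inE => /andP[hU ->]; rewrite andbT.
by have /forall_inP/(_ _ hU)/andP[] := valP h.
Qed.

Definition hg_restr (T : finType) (J P : {set T}) (h : hypergraph J) :
    hypergraph P := exist (fun k => hypergraph_on P k) _ (hg_restr_subproof P h).

Lemma hg_empty_subproof (T : finType) (J : {set T}) : hypergraph_on J set0.
Proof. by apply/forall_inP => U; rewrite inE. Qed.

Definition hg_empty (T : finType) (J : {set T}) : hypergraph J :=
  exist (fun k => hypergraph_on J k) _ (hg_empty_subproof J).

(* The default value 0 is never used on valid arguments. *)
Definition hg_vec (T : finType) (J : {set T}) (h : {set {set T}}) :
    {malg K[hypergraph J]} :=
  if insub h is Some g then << (g : hypergraph J) >> else 0.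

Definition elt_image (T T' : finType) (A : {set T}) (B : {set T'})
    (f : elt A -> elt B) (U : {set T}) : {set T'} :=
  [set val (f a) | a in [set a : elt A | val a \in U]].

Definition HG : hopf_data K := {|
  basis := fun T J => hypergraph J;
  relabel := fun T T' A B f =>
    lext (fun h : hypergraph A =>
            hg_vec B [set elt_image f U | U in val h]);
  hunit := fun T I => if I == set0 then << hg_empty I >> else 0;
  hcounit := fun T I =>
    lext (fun _ : hypergraph I => ((I == set0)%:R : K^o));
  mul := fun T I A B =>
    lext (fun p : hypergraph A * hypergraph B =>
            hg_vec I (val p.1 :|: val p.2));
  comul := fun T I A B =>
    lext (fun h : hypergraph I =>
            << (hg_restr A h, hg_restr B h) >>
              : {malg K[(hypergraph A * hypergraph B)%type]})
|}.

End Hypergraphs.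

Section HGIsHopf.
Variable K : fieldType.

Lemma malg_span (S : choiceType) (P : {malg K[S]} -> Prop) :
  P 0 -> (forall c u v, P u -> P v -> P (c *: u + v)) ->
  (forall s, P << s >>) -> forall v, P v.
Proof.
move=> P0 PD P1 v; rewrite [v]monalgE; elim: (enum_fset _) => [|s r IH].
  by rewrite big_nil.
rewrite big_cons; have -> : << v@_s *g s >> = v@_s *: << s >>.
  by apply/malgP => k; rewrite mcoeffZ !mcoeffU mulrnAr mulr1.
exact: PD.
Qed.

Lemma lin22 (S : choiceType) (V V' W : lmodType K)
    (f : {linear V -> W}) (g : {linear {malg K[S]} -> V})
    (f' : {linear V' -> W}) (g' : {linear {malg K[S]} -> V'}) :
  (forall s, f (g << s >>) = f' (g' << s >>)) -> forall t, f (g t) = f' (g' t).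
Proof. by move=> E t; apply: (malg_ext (f := f \o g) (g := f' \o g')). Qed.

Lemma lin21 (S : choiceType) (V W : lmodType K)
    (f : {linear V -> W}) (g : {linear {malg K[S]} -> V})
    (h : {linear {malg K[S]} -> W}) :
  (forall s, f (g << s >>) = h << s >>) -> forall t, f (g t) = h t.
Proof. by move=> E t; apply: (malg_ext (f := f \o g) (g := h)). Qed.

Lemma lin23 (S : choiceType) (V V' V'' W : lmodType K)
    (f : {linear V -> W}) (g : {linear {malg K[S]} -> V})
    (f' : {linear V' -> W}) (g' : {linear V'' -> V'})
    (k : {linear {malg K[S]} -> V''}) :
  (forall s, f (g << s >>) = f' (g' (k << s >>))) ->
  forall t, f (g t) = f' (g' (k t)).
Proof. by move=> E t; apply: (malg_ext (f := f \o g) (g := f' \o (g' \o k))). Qed.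

Lemma lin20 (S R : choiceType)
    (f : {linear {malg K[R]} -> {malg K[S]}})
    (g : {linear {malg K[S]} -> {malg K[R]}}) :
  (forall s, f (g << s >>) = << s >>) -> forall t, f (g t) = t.
Proof. by move=> E t; apply: (malg_ext (f := f \o g) (g := idfun)). Qed.

Lemma lmapU (S R : choiceType) (phi : S -> R) (s : S) :
  lmap phi << s >> = << phi s >> :> {malg K[R]}.
Proof. exact: lextU. Qed.

Lemma tensUU (S R : choiceType) (s : S) (r : R) :
  tens (<< s >> : {malg K[S]}) << r >> = << (s, r) >>.
Proof. by rewrite /tens !lextU. Qed.

Lemma tmapU (S R S' R' : choiceType)
    (f : {malg K[S]} -> {malg K[S']}) (g : {malg K[R]} -> {malg K[R']}) s r :
  tmap f g << (s, r) >> = tens (f << s >>) (g << r >>).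
Proof. exact: lextU. Qed.

Lemma hg_vecE (T : finType) (J : {set T}) (g : hypergraph J) :
  hg_vec K J (val g) = << g >>.
Proof. by rewrite /hg_vec valK. Qed.

Lemma hg_vec_ex (T : finType) (J : {set T}) (h : {set {set T}}) :
  hypergraph_on J h -> exists2 g : hypergraph J, hg_vec K J h = << g >> & val g = h.
Proof. by move=> hJ; exists (exist (fun k => hypergraph_on J k) h hJ); rewrite // -hg_vecE. Qed.

Lemma hgP (T : finType) (J : {set T}) (g : hypergraph J) (U : {set T}) :
  U \in val g -> (1 < #|U|)%N /\ U \subset J.
Proof. by move=> gU; have /forall_inP/(_ _ gU)/andP[] := valP g. Qed.

Lemma hg_mulU (T : finType) (I A B : {set T}) (a : hypergraph A) (b : hypergraph B) :
  decomp I A B ->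
  exists2 g : hypergraph I,
    mul (HG K) I A B << (a, b) >> = << g >> & val g = val a :|: val b.
Proof.
move=> /andP[/eqP <- _]; rewrite /= lextU; apply: hg_vec_ex.
apply/forall_inP => U; rewrite inE => /orP[] /hgP[-> sU] /=.
  by rewrite subsetU ?sU.
by rewrite subsetU ?sU ?orbT.
Qed.

Lemma hg_comulU (T : finType) (I A B : {set T}) (g : hypergraph I) :
  comul (HG K) I A B << g >> = << (hg_restr A g, hg_restr B g) >>.
Proof. exact: lextU. Qed.

Lemma card_elt_image (T T' : finType) (A : {set T}) (B : {set T'})
    (f : elt A -> elt B) (U : {set T}) :
  bijective f -> U \subset A -> #|elt_image f U| = #|U|.
Proof.
move=> /bij_inj fI sU; rewrite card_imset; last by move=> a b /val_inj/fI.
rewrite -(card_imset _ val_inj); apply: eq_card => u.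
apply/imsetP/idP => [[a] | uU]; first by rewrite inE => aU ->.
by exists (exist (fun w => w \in A) u (subsetP sU u uU)); rewrite ?inE.
Qed.

Lemma elt_image_sub (T T' : finType) (A : {set T}) (B : {set T'})
    (f : elt A -> elt B) (U : {set T}) : elt_image f U \subset B.
Proof. by apply/subsetP => _ /imsetP[a _ ->]; exact: valP. Qed.

Lemma hg_relabelU (T T' : finType) (A : {set T}) (B : {set T'})
    (f : elt A -> elt B) (h : hypergraph A) : bijective f ->
  exists2 g : hypergraph B, relabel (HG K) f << h >> = << g >>
    & val g = [set elt_image f U | U in val h].
Proof.
move=> fB; rewrite /= lextU; apply: hg_vec_ex; apply/forall_inP => _ /imsetP[U /hgP[cU sU] ->].
by rewrite card_elt_image // cU elt_image_sub.
Qed.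

Lemma elt_image_id (T : finType) (A U : {set T}) : U \subset A ->
  elt_image (@id (elt A)) U = U.
Proof.
move=> sU; apply/setP => u; apply/imsetP/idP => [[a] | uU].
  by rewrite inE => aU ->.
by exists (exist (fun w => w \in A) u (subsetP sU u uU)); rewrite ?inE.
Qed.

Lemma elt_image_comp (T1 T2 T3 : finType) (A : {set T1}) (B : {set T2})
    (C : {set T3}) (f : elt A -> elt B) (g : elt B -> elt C) U :
  elt_image (g \o f) U = elt_image g (elt_image f U).
Proof.
apply/setP => u; apply/imsetP/imsetP => [[a] | [b]]; rewrite inE => H ->.
  by exists (f a) => //; rewrite inE; apply/imsetP; exists a; rewrite ?inE.
by case/imsetP: H => a; rewrite inE => aU /val_inj ->; exists a; rewrite ?inE.
Qed.

Lemma elt_image_restr (T T' : finType) (I A : {set T}) (J C : {set T'})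
    (f : elt I -> elt J) (g : elt A -> elt C) (U : {set T}) :
  A \subset I -> U \subset A -> restricts f g -> elt_image f U = elt_image g U.
Proof.
move=> sA sU fg; apply/setP => u; apply/imsetP/imsetP => [[i]|[a]]; rewrite inE => iU ->.
  exists (exist (fun w => w \in A) (val i) (subsetP sU _ iU)); rewrite ?inE //.
  exact: fg.
exists (exist (fun w => w \in I) (val a) (subsetP sA _ (valP a))); rewrite ?inE //.
by apply/esym/fg.
Qed.

Lemma elt_image_subset (T T' : finType) (I A : {set T}) (J C : {set T'})
    (f : elt I -> elt J) (g : elt A -> elt C) (U : {set T}) :
  A \subset I -> bijective f -> bijective g -> U \subset I -> restricts f g ->
  (elt_image f U \subset C) = (U \subset A).
Proof.
move=> sA fB gB sU fg; apply/idP/idP => [sfU|sUA]; last first.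
  by rewrite (elt_image_restr sA sUA fg) elt_image_sub.
apply/subsetP => u uU; pose i : elt I := exist (fun w => w \in I) u (subsetP sU u uU).
have fiC : val (f i) \in C.
  by apply: (subsetP sfU); apply/imsetP; exists i; rewrite ?inE.
case: gB => g' gK g'K; pose c : elt C := exist (fun w => w \in C) (val (f i)) fiC.
pose j : elt I := exist (fun w => w \in I) _ (subsetP sA _ (valP (g' c))).
have /val_inj/(bij_inj fB) /(congr1 val) /= <- : val (f j) = val (f i).
  by rewrite (fg j (g' c)) // g'K.
exact: (valP (g' c)).
Qed.

Lemma decompS (T : finType) (I A B : {set T}) : decomp I A B -> A \subset I /\ B \subset I.
Proof. by move=> /andP[/eqP <- _]; rewrite subsetUl subsetUr. Qed.

Lemma decompI (T : finType) (I A B C : {set T}) :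
  decomp I A B -> C \subset I -> decomp C (A :&: C) (B :&: C).
Proof.
move=> /andP[/eqP <- dAB] sC; rewrite /decomp -setIUl (setIidPr sC) eqxx /=.
by apply: disjointW dAB; rewrite subsetIl.
Qed.

Lemma decompA (T : finType) (I A B C : {set T}) :
  decomp (A :|: B) A B -> decomp I (A :|: B) C ->
  decomp (B :|: C) B C /\ decomp I A (B :|: C).
Proof.
rewrite /decomp eqxx /= => dAB /andP[/eqP <-]; rewrite setUA !eqxx /=.
rewrite -!setI_eq0 in dAB *; rewrite setIUl setIUr !setU_eq0.
by case/andP=> -> ->; rewrite dAB.
Qed.

Lemma decomp0l (T : finType) (I : {set T}) : decomp I set0 I.
Proof. by rewrite /decomp set0U eqxx disjoints_subset sub0set. Qed.

Lemma decomp0r (T : finType) (I : {set T}) : decomp I I set0.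
Proof. by rewrite /decomp setU0 eqxx disjoint_sym disjoints_subset sub0set. Qed.

Lemma hg_eq (T : finType) (J : {set T}) (g h : hypergraph J) :
  val g = val h -> (<< g >> : {malg K[hypergraph J]}) = << h >>.
Proof. by move/val_inj => ->. Qed.

Lemma hg_set0 (T : finType) (g : hypergraph (@set0 T)) : g = hg_empty set0.
Proof.
apply/val_inj/eqP; rewrite -subset0; apply/subsetP => U /hgP[cU].
by rewrite subset0 => /eqP U0; rewrite U0 cards0 in cU.
Qed.

Lemma hg_hunit (T : finType) : hunit (HG K) (@set0 T) = << hg_empty set0 >>.
Proof. by rewrite /= eqxx. Qed.

Lemma hg_hcounitU (T : finType) (I : {set T}) (g : hypergraph I) :
  hcounit (HG K) I << g >> = (I == set0)%:R.
Proof. exact: lextU. Qed.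

Lemma HG_species : is_species (HG K).
Proof.
split=> [T A v | T1 T2 T3 A B C f g v fB gB].
  apply: (malg_ext (g := idfun)) v => h.
  have [|g -> E] := @hg_relabelU _ _ _ _ (@id (elt A)) h; first by exists id.
  apply: hg_eq; rewrite E -[RHS]imset_id; apply: eq_in_imset => U /hgP[_ sU].
  exact: elt_image_id.
apply/esym; apply: lin21 v => h; apply/esym.
have [k -> Ek] := hg_relabelU h fB.
have [l -> El] := hg_relabelU k gB.
have [m -> Em] := hg_relabelU h (bij_comp gB fB).
apply: hg_eq; rewrite Em El Ek -imset_comp; apply: eq_imset => U /=.
exact: elt_image_comp.
Qed.

Lemma bij_set0 (T T' : finType) (I : {set T}) (J : {set T'}) (f : elt I -> elt J) :
  bijective f -> (I == set0) = (J == set0).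
Proof.
case=> g _ _; apply/eqP/eqP => E; apply/setP => u; rewrite inE; apply/negP => uI.
  have [w wI] := g (exist (fun w => w \in J) u uI).
  by move: wI; rewrite E inE.
have [w wJ] := f (exist (fun w => w \in I) u uI).
by move: wJ; rewrite E inE.
Qed.

Lemma HG_natural : is_natural (HG K).
Proof.
split=> [T T' I J f fB|T T' I J f v fB|T T' I A B J C D f g k t dI dJ fB gB kB fg fk
  |T T' I A B J C D f g k v dI dJ fB gB kB fg fk].
- rewrite [hunit _ _]/= [hunit _ _]/= -(bij_set0 fB); case: ifP => _; last by rewrite linear0.
  have [h -> E] := hg_relabelU (hg_empty I) fB.
  by apply: hg_eq; rewrite E imset0.
- apply: (malg_ext (f := hcounit (HG K) J \o relabel (HG K) f)
    (g := hcounit (HG K) I)) => h.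
  change (hcounit (HG K) J (relabel (HG K) f << h >>) = hcounit (HG K) I << h >>).
  by have [k -> _] := hg_relabelU h fB; rewrite !hg_hcounitU (bij_set0 fB).
- apply: lin22 t => -[a b]; have [h -> Eh] := hg_mulU a b dI.
  rewrite tmapU; have [a' -> Ea] := hg_relabelU a gB; have [b' -> Eb] := hg_relabelU b kB.
  rewrite tensUU; have [h' -> Eh'] := hg_mulU a' b' dJ; have [l -> El] := hg_relabelU h fB.
  have [sA sB] := decompS dI.
  apply: hg_eq; rewrite El Eh Eh' Ea Eb imsetU; congr (_ :|: _);
    by apply: eq_in_imset => U /hgP[_ sU]; apply: elt_image_restr.
- apply: lin22 v => h; have [h' -> Eh'] := hg_relabelU h fB; have [sA sB] := decompS dI.
  rewrite !hg_comulU tmapU; have [a' -> Ea] := hg_relabelU (hg_restr A h) gB.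
  have [b' -> Eb] := hg_relabelU (hg_restr B h) kB; rewrite tensUU.
  suff main (X : {set T}) (Y : {set T'}) (sX : X \subset I) (l : elt X -> elt Y) (lB : bijective l) (fl : restricts f l) r :
    val r = [set elt_image l U | U in val (hg_restr X h)] -> hg_restr Y h' = r.
    by rewrite (main _ _ sA _ gB fg a' Ea) (main _ _ sB _ kB fk b' Eb).
  move=> Er; apply/val_inj; rewrite Er /= Eh'; apply/setP => V.
  rewrite inE; apply/andP/imsetP => [[/imsetP[U hU ->]] sV | [U + ->]].
    have [_ sU] := hgP hU; rewrite (elt_image_subset sX fB lB sU fl) in sV.
    by exists U; rewrite ?inE ?hU // (elt_image_restr sX sV fl).
  rewrite inE => /andP[hU sU]; rewrite -(elt_image_restr sX sU fl) imset_f //; split=> //.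
  by rewrite (elt_image_subset sX fB lB (subset_trans sU sX) fl).
Qed.

Lemma HG_monoid : is_monoid (HG K).
Proof.
split=> [T I /negPf I0|T I v|T I v|T I A B C t dAB dI]; first by rewrite /= I0.
- have E (h : hypergraph I) :
      mul (HG K) I set0 I (tens << hg_empty set0 >> << h >>) = << h >>.
    rewrite tensUU; have [g -> Eg] := hg_mulU (hg_empty set0) h (decomp0l I).
    by apply: hg_eq; rewrite Eg set0U.
  rewrite hg_hunit {1}/tens lextU; apply: lin20 v => h.
  by rewrite -[RHS]E /tens lextU.
- have E (h : hypergraph I) :
      mul (HG K) I I set0 (tens << h >> << hg_empty set0 >>) = << h >>.
    rewrite tensUU; have [g -> Eg] := hg_mulU h (hg_empty set0) (decomp0r I).
    by apply: hg_eq; rewrite Eg setU0.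
  by rewrite hg_hunit {1}/tens; apply: lin20 v => h; rewrite -[RHS]E.
have [dBC dA] := decompA dAB dI.
apply: lin23 t => -[[a b] c]; rewrite /tassoc lmapU !tmapU /=.
have [ab -> Eab] := hg_mulU a b dAB; have [bc -> Ebc] := hg_mulU b c dBC.
rewrite !tensUU; have [l -> El] := hg_mulU ab c dI; have [r -> Er] := hg_mulU a bc dA.
by apply: hg_eq; rewrite El Er Eab Ebc setUA.
Qed.

Lemma hg_restr_restr (T : finType) (I J P : {set T}) (h : hypergraph I) :
  P \subset J -> hg_restr P (hg_restr J h) = hg_restr P h.
Proof.
move=> sP; apply/val_inj/setP => U; rewrite !inE -andbA; congr (_ && _).
by apply/andP/idP => [[]//|sU]; rewrite (subset_trans sU sP).
Qed.

Lemma hg_restrT (T : finType) (I : {set T}) (h : hypergraph I) : hg_restr I h = h.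
Proof.
apply/val_inj/setP => U; rewrite !inE.
by apply/andP/idP => [[]//|hU]; have [] := hgP hU.
Qed.

Lemma HG_comonoid : is_comonoid (HG K).
Proof.
split=> [T I v /negPf I0|T I v|T I v|T I A B C v dAB dI].
- elim/malg_span: v => [|c u v Eu Ev|h]; first by rewrite linear0.
    by rewrite (linearP (hcounit (HG K) I)) Eu Ev scaler0 addr0.
  by rewrite hg_hcounitU I0.
- apply: (lin20 (f := lext _)) v => h.
  rewrite hg_comulU; apply: etrans (lextU _ _) _.
  by rewrite hg_hcounitU eqxx scale1r hg_restrT.
- apply: (lin20 (f := lext _)) v => h.
  rewrite hg_comulU; apply: etrans (lextU _ _) _.
  by rewrite hg_hcounitU eqxx scale1r hg_restrT.
apply/esym; apply: lin23 v => h; apply/esym; rewrite !hg_comulU !tmapU !hg_comulU !tensUU /tassoc lmapU /=.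
by rewrite !hg_restr_restr // ?subsetUl ?subsetUr.
Qed.

Lemma HG_compatible : is_compatible (HG K).
Proof.
split=> [T|T|T u v|T I A B C D t dI dI'].
- by rewrite hg_hunit hg_hcounitU eqxx.
- by rewrite hg_hunit hg_comulU tensUU; congr (<< (_, _) >>); exact: hg_set0.
- have E (g h : hypergraph (@set0 T)) : hcounit (HG K) set0
      (mul (HG K) set0 set0 set0 (tens << g >> << h >>)) = 1.
    rewrite tensUU; have [k -> _] := hg_mulU g h (decomp0l set0).
    by rewrite hg_hcounitU eqxx.
  have E1 (g : hypergraph (@set0 T)) : hcounit (HG K) set0
      (mul (HG K) set0 set0 set0 (tens << g >> v)) = hcounit (HG K) set0 v.
    rewrite {1}/tens lextU; apply: (malg_ext (f := hcounit (HG K) set0 \o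
      (mul (HG K) set0 set0 set0 \o lext _)) (g := hcounit (HG K) set0)) => h.
    have := E g h; rewrite {1}/tens lextU => E'.
    by rewrite hg_hcounitU eqxx; exact: E'.
  rewrite mulrC {1}/tens; apply: (malg_ext (f := hcounit (HG K) set0 \o
    (mul (HG K) set0 set0 set0 \o lext _))
    (g := hcounit (HG K) set0 v \*: hcounit (HG K) set0)) => g.
  apply: etrans (E1 g) _; apply/esym.
  change (hcounit (HG K) set0 v * hcounit (HG K) set0 << g >> = hcounit (HG K) set0 v).
  by rewrite hg_hcounitU eqxx mulr1.
apply: (lin23 (g' := tmid) (k := tmap _ _)) t => -[a b]; have [sC sD] := decompS dI'.
have [h -> Eh] := hg_mulU a b dI.
rewrite hg_comulU tmapU !hg_comulU tensUU /tmid lmapU tmapU /=.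
have [l -> El] := hg_mulU (hg_restr (A :&: C) a) (hg_restr (B :&: C) b) (decompI dI sC).
have [r -> Er] := hg_mulU (hg_restr (A :&: D) a) (hg_restr (B :&: D) b) (decompI dI sD).
suff main (X : {set T}) (k : hypergraph X) :
    val k = val (hg_restr (A :&: X) a) :|: val (hg_restr (B :&: X) b) -> hg_restr X h = k.
  by rewrite tensUU (main _ _ El) (main _ _ Er).
move=> Ek; apply/val_inj; rewrite Ek /= Eh; apply/setP => U; rewrite !inE !subsetI andb_orl.
by congr (_ || _); case: (boolP (U \in _)) => //= /hgP[_ ->].
Qed.

Lemma HG_connected : is_connected (HG K).
Proof.
move=> T v; elim/malg_span: v => [|c u v Eu Ev|h].
- by rewrite linear0 scale0r.
- have -> : hcounit (HG K) set0 (c *: u + v)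
      = c * hcounit (HG K) set0 u + hcounit (HG K) set0 v by exact: linearP.
  by rewrite scalerDl -scalerA -Eu -Ev.
by rewrite hg_hcounitU eqxx scale1r hg_hunit [h]hg_set0.
Qed.

Lemma HG_hopf_monoid : connected_hopf_monoid (HG K).
Proof.
split; [exact: HG_species | exact: HG_natural | exact: HG_monoid
  | exact: HG_comonoid | exact: HG_compatible | exact: HG_connected].
Qed.

Lemma HG_commutative : commutative_monoid (HG K).
Proof.
move=> T I A B t dI; have dI' : decomp I B A by rewrite /decomp setUC disjoint_sym.
apply: lin21 t => -[a b]; rewrite /tswap lmapU /=.
have [g -> Eg] := hg_mulU a b dI; have [h -> Eh] := hg_mulU b a dI'.
by apply: hg_eq; rewrite Eg Eh setUC.
Qed.

Lemma HG_cocommutative : cocommutative_comonoid (HG K).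
Proof. by move=> T I A B v dI; apply: lin21 v => h; rewrite !hg_comulU /tswap lmapU. Qed.

Lemma HG_linearized : linearized (HG K).
Proof.
split=> [T I A B a b dI|T I A B x _]; first by have [g] := hg_mulU a b dI; exists g.
by right; exists (hg_restr A x), (hg_restr B x); rewrite hg_comulU.
Qed.

End HGIsHopf.

(* Main.v *)
Require Import Defs.
From HB Require Import structures.
From mathcomp Require Import all_boot all_order all_algebra.
From mathcomp Require Import finmap.
From mathcomp.multinomials Require Import monalg.

Set Implicit Arguments.
Unset Strict Implicit.
Unset Printing Implicit Defensive.

Import GRing.Theory.
Local Open Scope ring_scope.

(** Basis elements of [H] on the subsets of a fixed set form a partial
    commutative monoid, and the coproduct restricts them to subsets.  The
    compatibility axiom says that product and restriction interact as for sets;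
    in particular the restriction of a product to the ground set of a factor is
    that factor, so factorisations are unique once their ground sets are given.

    Write [y = l_1 ... l_m] for the factorisation along a minimal [L].
    Minimality makes every [l_i] irreducible: splitting one factor of [y] would
    refine [L] inside C_x^y.  If [A] is in C_x^y then [y] factors along [A], and
    restricting this factorisation to a part of [L] factors [l_i]; hence each
    part of [L] lies in a part of [A], that is, [A] comes from a set composition
    [a] of [[m]].  Conversely such an [A] is in C_x^y iff, for every part [V] of
    [a], the product of the [l_i] over [V] is a restriction of [x].  This
    property of [V] is inherited by subsets, so it says that [V] contains no
    minimal violator, i.e. no hyperedge of the hypergraph x/y, which is the
    condition defining the coefficient of the empty hypergraph in HG. *)

(** * Unions indexed by sequences *)

Lemma bigcup_seq_sup (T : finType) (S : eqType) (F : S -> {set T}) (s : seq S) i :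
  i \in s -> F i \subset \bigcup_(j <- s) F j.
Proof. by move=> si; rewrite (big_rem i) //= subsetUl. Qed.

Lemma bigcup_seqP (T : finType) (S : eqType) (F : S -> {set T}) (s : seq S) t :
  reflect (exists2 i, i \in s & t \in F i) (t \in \bigcup_(i <- s) F i).
Proof.
elim: s => [|i s IH]; first by rewrite big_nil inE; constructor=> -[].
rewrite big_cons inE; apply: (iffP orP) => [[ti|/IH[j js tj]]|[j]].
- by exists i; rewrite ?mem_head.
- by exists j; rewrite // inE js orbT.
by rewrite inE => /orP[/eqP->|js] tj; [left | right; apply/IH; exists j].
Qed.

Lemma bigcup_seq_disjoint (T : finType) (S : eqType) (F : S -> {set T})
    (s : seq S) (P : {set T}) :
  (forall i, i \in s -> [disjoint F i & P]) -> [disjoint \bigcup_(i <- s) F i & P].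
Proof.
move=> FP; apply/pred0P => t /=; apply/negP => /andP[/bigcup_seqP[i si ti] tP].
by have /pred0P/(_ t) /= := FP i si; rewrite ti tP.
Qed.

(** * Partial decompositions of elements with a ground set *)

Section Splitting.
Variables (T : finType) (E : eqType) (tg : E -> {set T}).

(** Relations accommodate both operations: products are taken over disjoint ground sets and
    coproducts may vanish. Products and coproducts then share one theory of iterated
    decompositions. *)
Record splitting (R : E -> E -> E -> Prop) : Prop := Splitting {
  split_decomp : forall x a b, R x a b -> decomp (tg x) (tg a) (tg b);
  split_sym : forall x a b, R x a b -> R x b a;
  split_assoc : forall x u a b c, R x u c -> R u a b ->
    exists2 v, R x a v & R v b c;
  split_empty : exists z, tg z = set0;
  split_unit : forall x z, tg z = set0 -> R x z x;
  split_unit_eq : forall x y z, tg z = set0 -> R x z y -> x = y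
}.

Fixpoint splits (R : E -> E -> E -> Prop) (x : E) (l : seq E) : Prop :=
  if l is a :: l' then exists2 y, R x a y & splits R y l' else tg x = set0.

Section Theory.
Variables (R : E -> E -> E -> Prop) (sR : splitting R).

Lemma split_tg x a b : R x a b -> tg x = tg a :|: tg b.
Proof. by move/(split_decomp sR)/andP => [/eqP]. Qed.

Lemma split_disjoint x a b : R x a b -> [disjoint tg a & tg b].
Proof. by move/(split_decomp sR)/andP => []. Qed.

Lemma splits_cat x l1 l2 :
  splits R x (l1 ++ l2) <->
  exists u v, [/\ R x u v, splits R u l1 & splits R v l2].
Proof.
elim: l1 x => [|a l1 IH] x /=.
  split=> [xl|[u [v [Ruv u0 vl]]]].
    have [z z0] := split_empty sR.
    by exists z, x; split=> //; apply: (split_unit sR).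
  by rewrite (split_unit_eq sR u0 Ruv).
split=> [[y Ry /IH[u [v [Ruv ul vl]]]]|[u [v [Ruv [y Ry yl] vl]]]].
  (* [split_assoc] regroups in one direction only; reversing the splittings by symmetry gives the
     other direction. *)
  have [w Rw Rw'] := split_assoc sR (split_sym sR Ry)
    (split_sym sR Ruv).
  exists w, v; split=> //; first exact: (split_sym sR Rw).
  by exists u => //; apply: (split_sym sR Rw').
have [w Rw Rw'] := split_assoc sR Ruv Ry.
by exists w => //; apply/IH; exists y, v.
Qed.

(** Permutations are generated by exchanges of the two leading blocks of a concatenation, which
    symmetry and associativity allow. *)
Lemma splits_perm x l1 l2 : perm_eq l1 l2 -> splits R x l1 -> splits R x l2.
Proof.
move: l1 l2; apply: catCA_perm_ind => l1 l2 l3.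
case/splits_cat=> u [v [Ruv ul /splits_cat[w [t [Rwt wl tl]]]]].
have [s Rs Rs'] := split_assoc sR (split_sym sR Ruv) Rwt.
apply/splits_cat; exists w, s; split=> //; apply/splits_cat.
by exists u, t; split=> //; apply: (split_sym sR Rs').
Qed.

Lemma splits_tg x l : splits R x l -> tg x = \bigcup_(a <- l) tg a.
Proof.
elim: l x => [|a l IH] x /=; first by rewrite big_nil.
by case=> y /split_tg -> /IH ->; rewrite big_cons.
Qed.

Lemma splits_pairwise x l : splits R x l ->
  pairwise (fun P Q : {set T} => [disjoint P & Q]) (map tg l).
Proof.
elim: l x => [|a l IH] x //= [y Ry yl]; rewrite (IH y) // andbT.
apply/allP => _ /mapP[b bl ->]; have := split_disjoint Ry.
rewrite (splits_tg yl); apply: disjointWr.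
exact: bigcup_seq_sup.
Qed.

Lemma splits_mem x l a : splits R x l -> a \in l ->
  exists2 b, R x a b & splits R b (rem a l).
Proof. by move=> xl al; exact: (splits_perm (perm_to_rem al) xl). Qed.

Lemma splits_id x : splits R x [:: x].
Proof.
have [z z0] := split_empty sR.
by exists z => //; apply/(split_sym sR)/(split_unit sR).
Qed.

Lemma splits_refine x l1 l2 u p q : splits R x (l1 ++ u :: l2) -> R u p q ->
  splits R x (l1 ++ p :: q :: l2).
Proof.
case/splits_cat=> a [b [Rab al [c Rbc cl]]] Rupq; apply/splits_cat.
have [t Rt Rt'] := split_assoc sR Rbc Rupq.
by exists a, b; split=> //; exists t => //; exists c.
Qed.

(** Coarsening: associativity merges each block into a single piece, and [w] collects these
    pieces. *)
Lemma splits_flatten (S : Type) (f : S -> seq E) x (s : seq S) :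
  splits R x (flatten (map f s)) ->
  exists2 w, splits R x w
    & map tg w = [seq \bigcup_(a <- f j) tg a | j <- s].
Proof.
elim: s x => [|j s IH] x /=; first by exists [::].
case/splits_cat=> u [v [Ruv /splits_tg uE /IH[w vw wE]]].
by exists (u :: w); [exists v | rewrite /= wE uE].
Qed.

End Theory.

(* In [mu x a b] and [co x a b], [x] is the product of [a] and [b], respectively
   the coproduct of [x] is the tensor of [a] and [b]. *)
Record bisplitting (mu co : E -> E -> E -> Prop) : Prop := Bisplitting {
  mu_splitting : splitting mu;
  co_splitting : splitting co;
  mu_functional : forall x y a b, mu x a b -> mu y a b -> x = y;
  co_functional : forall x a b a' b', co x a b -> co x a' b' ->
    tg a = tg a' -> a = a';
  co_mu : forall x a b, mu x a b -> co x a b;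
  (* the compatibility axiom, keeping only the first tensor factor *)
  co_of_mu : forall x a b c d, mu x a b -> co x c d ->
    exists p q, [/\ mu c p q, tg p = tg a :&: tg c & tg q = tg b :&: tg c]
}.

(** * Products and coproducts together *)

Section BiTheory.
Variables (mu co : E -> E -> E -> Prop) (B : bisplitting mu co).
Let sM := mu_splitting B.
Let sC := co_splitting B.

Lemma mu_empty_eq z z' : tg z = set0 -> tg z' = set0 -> z = z'.
Proof.
move=> z0 z'0; apply/esym/(split_unit_eq sM z'0)/(split_sym sM).
exact: (split_unit sM _ z0).
Qed.

Lemma splits_mu_co x l : splits mu x l -> splits co x l.
Proof.
elim: l x => [|a l IH] x //= [y /(co_mu B) xy /IH yl].
by exists y.
Qed.

Lemma splits_mu_functional x y l : splits mu x l -> splits mu y l -> x = y.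
Proof.
elim: l x y => [|a l IH] x y /=; first exact: mu_empty_eq.
move=> [u xu ul] [v yv vl]; have uv := IH _ _ ul vl; rewrite -uv in yv.
exact: (mu_functional B xu yv).
Qed.

(** [co_functional] compares first pieces only; the remainders agree by symmetry, since both have
    the same ground set. *)
Lemma splits_co_functional x l l' : splits co x l -> splits co x l' ->
  map tg l = map tg l' -> l = l'.
Proof.
elim: l l' x => [|a l IH] [|a' l'] x //= [y xy yl] [y' xy' yl'] [Ea El].
have Eaa := co_functional B xy xy' Ea.
rewrite -{}Eaa in xy' *; congr cons.
have Eyy : y = y'.
  have sxy := split_sym sC xy; have sxy' := split_sym sC xy'.
  apply: (co_functional B sxy sxy').
  by rewrite (splits_tg sC yl) (splits_tg sC yl')
    -!(big_map tg xpredT id) El.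
by apply: (IH _ y) => //; rewrite Eyy.
Qed.

Lemma co_trans x w v p q : co x w v -> co w p q -> exists r, co x p r.
Proof. by move=> xw wp; have [r xr _] := split_assoc sC xw wp; exists r. Qed.

Lemma eq_map_tg (l l' : seq E) : map tg l = map tg l' ->
  (forall a b, a \in l -> b \in l' -> tg a = tg b -> a = b) -> l = l'.
Proof.
elim: l l' => [|a l IH] [|b l'] //= [ab El] inj; congr cons.
  by apply: inj; rewrite ?mem_head.
by apply: IH => // a' b' al bl; apply: inj; rewrite inE ?al ?bl orbT.
Qed.

(** * Subproducts of a fixed factorisation *)

Section Factorisation.
Variables (x y : E) (m : nat) (F : 'I_m -> E).
Hypotheses (xF : splits co x (codom F)) (yF : splits mu y (codom F)).

Implicit Types U V P : {set 'I_m}.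

Definition region (U : {set 'I_m}) : {set T} := \bigcup_(i in U) tg (F i).
Definition factors (U : {set 'I_m}) : seq E := [seq F i | i <- enum U].
(** Relational form of the condition tested by [prod_eq_restr]. The restriction of [x] need not be
    named, as its ground set determines it. *)
Definition product_restr (U : {set 'I_m}) : Prop :=
  exists2 p, splits mu p (factors U) & exists q, co x p q.

Lemma region_factors U : \bigcup_(a <- factors U) tg a = region U.
Proof. by rewrite big_map big_enum. Qed.

Lemma factorsU U V : [disjoint U & V] ->
  perm_eq (factors (U :|: V)) (factors U ++ factors V).
Proof.
move=> UV; rewrite -map_cat perm_map // uniq_perm ?enum_uniq //.
  rewrite cat_uniq !enum_uniq andbT /=; apply/hasPn => i; rewrite !mem_enum => iV.
  by rewrite (disjointFl UV).
by move=> i; rewrite mem_cat !mem_enum inE.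
Qed.

Lemma factorsCU U : perm_eq (codom F) (factors U ++ factors (~: U)).
Proof.
have UC : [disjoint U & ~: U] by rewrite -setI_eq0 setICr.
have -> : codom F = factors (U :|: ~: U).
  by rewrite setUCr /codom /image_mem; congr map; apply: eq_enum => i; rewrite !inE.
exact: factorsU.
Qed.

Lemma factor_disjoint i j : i != j -> [disjoint tg (F i) & tg (F j)].
Proof.
move=> ij; have /(splits_perm sC)/(_ xF) : perm_eq (codom F)
    ([:: F i] ++ [:: F j] ++ factors (~: [set i; j])).
  apply: perm_trans (factorsCU [set i; j]) _; rewrite catA perm_cat2r.
  have := @factorsU [set i] [set j]; rewrite /factors !enum_set1; apply.
  rewrite -setI_eq0; apply/eqP/setP => k; rewrite !inE.
  by case: (k =P i) => [->|//]; rewrite (negPf ij).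
by move/(splits_pairwise sC) => /= /andP[/andP[]].
Qed.

(** The product over [P] is a factor of the product over [U], hence a restriction of it by [co_mu],
    and a restriction of a restriction of [x] is one of [x]. *)
Lemma product_restr_sub (P U : {set 'I_m}) : P \subset U ->
  product_restr U -> product_restr P.
Proof.
move=> PU [u uU [v xuv]].
have PD : [disjoint P & U :\: P].
  by rewrite -setI_eq0; apply/eqP/setP => i; rewrite !inE; case: (i \in P).
have /(splits_perm sM) := factorsU PD.
have -> : P :|: U :\: P = U by rewrite -{1}(setIidPr PU) setID.
move/(_ _ uU)/(splits_cat sM) => [p [q [upq pP _]]].
by exists p => //; apply: (co_trans xuv (co_mu B upq)).
Qed.

Lemma product_restr0 : product_restr set0.
Proof.
have [z z0] := split_empty sM; exists z; first by rewrite /factors enum_set0.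
by exists x; apply: (split_unit sC).
Qed.

Lemma product_restr1 i : product_restr [set i].
Proof.
exists (F i); first by rewrite /factors enum_set1; apply: (splits_id sM).
by have [q xq _] := splits_mem sC xF (codom_f F i); exists q.
Qed.

Lemma factors_partition (s : seq {set 'I_m}) : set_comp [set: 'I_m] s ->
  perm_eq (codom F) (flatten (map factors s)).
Proof.
case/and3P=> _ sd /eqP sT.
have -> : flatten (map factors s) = map F (flatten [seq enum (pred_of_set U) | U <- s]).
  by rewrite map_flatten -map_comp.
apply: perm_map; apply: uniq_perm; first exact: enum_uniq; last first.
  move=> i; rewrite mem_enum inE; apply/esym/flatten_mapP.
  have : i \in \bigcup_(P <- s) P by rewrite sT inE.
  by case/bigcup_seqP=> U sU iU; exists U; rewrite ?mem_enum.
elim: s sd {sT} => [|U s IH] //= /andP[Us sd].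
rewrite cat_uniq enum_uniq (IH sd) andbT /=; apply/hasPn => i.
case/flatten_mapP=> V sV; rewrite !mem_enum => iV.
by rewrite (disjointFl (allP Us V sV)).
Qed.

Lemma co_factors U : exists p, [/\ splits mu p (factors U), tg p = region U
  & exists q, co y p q].
Proof.
have [p [q [/(co_mu B) ypq pU _]]] := (splits_cat sM _ _ _).1
  (splits_perm sM (factorsCU U) yF).
exists p; split=> //; last by exists q.
by rewrite (splits_tg sM pU) region_factors.
Qed.

(** Grouping the factors along [s] cuts [y] into products [v] and [x] into restrictions [w] over the
    same ground sets. The composition belongs to the class of [x] and [y] when these two lists
    agree, which is a condition on each part separately. *)
Lemma product_restr_splits (s : seq {set 'I_m}) : set_comp [set: 'I_m] s ->
  (forall U, U \in s -> product_restr U) <->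
  (exists l, [/\ map tg l = map region s, splits co x l & splits mu y l]).
Proof.
move=> sT; split=> [gs|[l [lE xl yl]] U sU].
  have perms := factors_partition sT.
  have [w xw wE] := splits_flatten sC (splits_perm sC perms xF).
  have [v yv vE] := splits_flatten sM (splits_perm sM perms yF).
  suff vw : v = w.
    exists w; split=> //; last by rewrite -vw.
    by rewrite wE; apply: eq_map => U; apply: region_factors.
  apply: eq_map_tg => [|a b va wb ab]; first by rewrite vE.
  have : tg a \in map tg v by rewrite map_f.
  rewrite vE => /mapP[U sU]; rewrite region_factors => aU.
  (* The product over [U] is a restriction of both [x] and [y], so uniqueness of restrictions
     identifies it with both [a] and [b]. *)
  have [p pU [q xpq]] := gs U sU.
  have [p' [p'U p'E [q' ypq]]] := co_factors U.
  have pp' := splits_mu_functional pU p'U; rewrite -{p'}pp' in p'U p'E ypq.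
  have [r ya _] := splits_mem sM yv va; have [r' xb _] := splits_mem sC xw wb.
  rewrite (co_functional B (co_mu B ya) ypq) ?aU //.
  by apply/esym/(co_functional B xb xpq); rewrite -ab aU.
(* Conversely, the entry of [l] over [region U] is a restriction of [y], hence the product over [U];
   it is also a restriction of [x]. *)
have : region U \in map tg l by rewrite lE map_f.
case/mapP=> a la aU; have [p [pU pE [q ypq]]] := co_factors U.
have [r /(co_mu B) ya _] := splits_mem sM yl la.
have [r' xa _] := splits_mem sC xl la.
have pa : p = a by apply: (co_functional B ypq ya); rewrite pE.
by exists p => //; exists r'; rewrite pa.
Qed.

Hypothesis F_neq0 : forall i, tg (F i) != set0.

Lemma mem_region t i U : t \in tg (F i) -> (t \in region U) = (i \in U).
Proof.
move=> ti; apply/bigcupP/idP => [[j jU tj]|iU]; last by exists i.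
by have [->//|/factor_disjoint ij] := eqVneq i j; rewrite (disjointFr ij ti) in tj.
Qed.

Lemma region_sub U V : (region U \subset region V) = (U \subset V).
Proof.
apply/idP/idP => [/subsetP UV|/subsetP UV].
  apply/subsetP => i iU; have /set0Pn[t ti] := F_neq0 i.
  by rewrite -(mem_region _ ti) UV // (mem_region _ ti).
by apply/bigcupsP => i iU; rewrite bigcup_sup ?UV.
Qed.

Lemma region_inj : injective region.
Proof. by move=> U V UV; apply/eqP; rewrite eqEsubset -!region_sub UV !subxx. Qed.

Lemma region_disjoint U V : [disjoint region U & region V] = [disjoint U & V].
Proof.
apply/pred0P/pred0P => UV i /=.
  have /set0Pn[t ti] := F_neq0 i; have := UV t.
  by rewrite /= !(mem_region _ ti).
apply/negP => /andP[/bigcupP[j jU tj]]; rewrite (mem_region _ tj) => jV.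
by have := UV j; rewrite /= jU jV.
Qed.

Lemma region0 : region set0 = set0. Proof. exact: big_set0. Qed.

(** Since the factors are nonempty and pairwise disjoint, [region] is injective and respects unions,
    disjointness and emptiness. *)
Lemma set_comp_region (s : seq {set 'I_m}) :
  set_comp (tg y) (map region s) = set_comp [set: 'I_m] s.
Proof.
have yE : tg y = region [set: 'I_m].
  rewrite (splits_tg sM yF) big_map big_enum.
  by rewrite /region; apply: eq_big => i; rewrite ?inE.
have suppE : \bigcup_(P <- map region s) P = region (\bigcup_(U <- s) U).
  rewrite big_map; elim: s => [|U s IH]; first by rewrite !big_nil region0.
  by rewrite !big_cons IH /region bigcup_setU.
rewrite /set_comp suppE yE (inj_eq region_inj); congr [&& _, _ & _].
  by rewrite all_map; apply: eq_all => U /=; rewrite -region0 (inj_eq region_inj).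
by rewrite pairwise_map; apply: eq_pairwise => U V /=; apply: region_disjoint.
Qed.

Hypothesis F_irreducible : forall i p q,
  mu (F i) p q -> tg p = set0 \/ tg q = set0.

(** Restricting the product of [a] and the remaining factors to [tg (F i)] factors [F i] into its
    traces on both; irreducibility makes one trace empty. *)
Lemma factor_sub l a i : splits mu y l -> a \in l ->
  (tg (F i) \subset tg a) || [disjoint tg (F i) & tg a].
Proof.
move=> yl la; have [r yar _] := splits_mem sM yl la.
have [q yiq _] := splits_mem sC (splits_mu_co yF) (codom_f F i).
have [p [p' [/[dup] ipp' /F_irreducible[] p0 pE p'E]]] := co_of_mu B yar yiq.
  by rewrite disjoint_sym -setI_eq0 -pE p0 eqxx orbT.
by rewrite (split_tg sM ipp') p0 setU0 pE subsetIl.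
Qed.

Lemma splits_region l : splits mu y l -> exists s, map tg l = map region s.
Proof.
(* Each part collects the indices of the factors inside it; by [factor_sub] all other factors miss
   it. *)
move=> yl; exists [seq [set i | tg (F i) \subset tg a] | a <- l].
rewrite -map_comp; apply/eq_in_map => a la /=; apply/eqP; rewrite eqEsubset.
apply/andP; split; last by apply/bigcupsP => i; rewrite inE.
apply/subsetP => t ta; have : t \in tg y.
  by rewrite (splits_tg sM yl); apply/bigcup_seqP; exists a.
rewrite (splits_tg sM yF) => /bigcup_seqP[_ /codomP[i ->] ti].
apply/bigcupP; exists i; rewrite // inE.
by have /orP[//|/disjointFr/(_ ti)] := factor_sub i yl la; rewrite ta.
Qed.

End Factorisation.
End BiTheory.
End Splitting.

(** * Basis vectors of free modules *)

Section FreeModuleBasis.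
Variable K : fieldType.

Lemma malgU_inj (S : choiceType) (a b : S) :
  << a >> = << b >> :> {malg K[S]} -> a = b.
Proof.
move=> /(congr1 (mcoeff a)); rewrite !mcoeffU eqxx.
by case: (b =P a) => [->//|_] /eqP; rewrite oner_eq0.
Qed.

Lemma malgU_neq0 (S : choiceType) (a : S) : << a >> != 0 :> {malg K[S]}.
Proof.
apply/eqP => /(congr1 (mcoeff a)); rewrite mcoeffU eqxx mcoeff0.
by move/eqP; rewrite oner_eq0.
Qed.

Lemma tens0l (S R : choiceType) (v : {malg K[R]}) :
  tens (0 : {malg K[S]}) v = 0.
Proof. by rewrite /tens linear0. Qed.

Lemma tensU0 (S R : choiceType) (a : S) :
  tens << a >> (0 : {malg K[R]}) = 0.
Proof. by rewrite /tens lextU linear0. Qed.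

End FreeModuleBasis.

(** * Basis elements of a linearized Hopf monoid *)

Section LinearizedMonoid.
Variables (K : fieldType) (H : hopf_data K).
Hypotheses (hopfH : connected_hopf_monoid H) (linH : linearized H).

Lemma hunit_basis (T : finType) : exists e : basis H (@set0 T),
  [/\ hunit H set0 = << e >>, hcounit H set0 << e >> = 1 & forall a, a = e].
Proof.
have [_ _ monH _ comH conH] := hopfH.
have [supp0|[e _]] := fset_0Vmem (msupp (hunit H (@set0 T))).
  have u0 : hunit H (@set0 T) = 0.
    by apply/malgP => k; rewrite mcoeff_outdom ?supp0 ?in_fset0 ?mcoeff0.
  by have := counit_unit comH T; rewrite u0 linear0 => /eqP; rewrite eq_sym oner_eq0.
(* By connectedness [a] and [e] are both multiples of the unit. If they differed, comparing
   coefficients at [e] would give [a] counit zero, making it vanish. *)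
have uniq_e a : a = e.
  apply: contraTeq (malgU_neq0 K a) => ae; rewrite negbK.
  have Ea := conH T << a >>; have Ee := conH T << e >>.
  have := congr1 (fun v => hcounit H set0 << e >> *: v) Ea.
  rewrite scalerA mulrC -scalerA -Ee => /(congr1 (mcoeff e)).
  rewrite !mcoeffZ !mcoeffU eqxx (negPf ae) mulr0 mulr1 => c0.
  by rewrite Ea -c0 scale0r.
have Ee := conH T << e >>.
(* The square of [e] is a basis element, hence [e] itself; as [e] is its counit times the unit, that
   counit is 1. *)
have [f ef] := linH.1 _ _ _ _ e e (decomp0l (@set0 T)).
have c1 : hcounit H set0 << e >> = 1.
  have := ef; rewrite [f]uniq_e -tensUU {1}Ee {1}/tens linearZ /=.
  rewrite linearZ /= -/(tens _ _) (mul_1l monH) => /(congr1 (mcoeff e)).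
  by rewrite mcoeffZ !mcoeffUU mulr1.
by exists e; split=> //; rewrite Ee c1 scale1r.
Qed.

Section Labelled.
Variable T : finType.

(* Carrying the ground set as a tag avoids transports between elements over
   equal but not convertible sets, such as [A] and [A :&: A]. *)
Definition labelled : eqType := {A : {set T} & basis H A}.
Definition lab (A : {set T}) (a : basis H A) : labelled :=
  Tagged (fun A => basis H A : Type) a.
Definition ground (a : labelled) : {set T} := tag a.

Definition is_mul (x a b : labelled) : Prop :=
  decomp (tag x) (tag a) (tag b) /\
  Defs.mul H (tag x) (tag a) (tag b) << (tagged a, tagged b) >> = << tagged x >>.

Definition is_comul (x a b : labelled) : Prop :=
  decomp (tag x) (tag a) (tag b) /\
  comul H (tag x) (tag a) (tag b) << tagged x >> = << (tagged a, tagged b) >>.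

Lemma lab_inj A (a b : basis H A) : lab a = lab b -> a = b.
Proof. exact: eq_from_Tagged. Qed.

Lemma decompC (I A B : {set T}) : decomp I A B = decomp I B A.
Proof. by rewrite /decomp setUC disjoint_sym. Qed.

Lemma is_mul_unit (x z : labelled) : ground z = set0 -> is_mul x z x.
Proof.
have [e [ue _ eE]] := hunit_basis T; have [_ _ monH _ _ _] := hopfH.
case: x z => [I x] [Z z]; rewrite /ground /= => Z0; subst Z.
split=> /=; first exact: decomp0l.
by rewrite [z]eE -tensUU -ue (mul_1l monH).
Qed.

Lemma is_comul_unit (x z : labelled) : ground z = set0 -> is_comul x z x.
Proof.
have [e [_ ce eE]] := hunit_basis T; have [_ _ _ comonH _ _] := hopfH.
case: x z => [I x] [Z z]; rewrite /ground /= => Z0; subst Z.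
split=> /=; first exact: decomp0l.
have := comul_1l comonH << x >>.
have [->|[a [b ->]]] := linH.2 _ _ _ _ x (decomp0l I).
  by rewrite linear0 => /esym/eqP; rewrite (negPf (malgU_neq0 _ _)).
by rewrite lextU /= [a]eE [z]eE ce scale1r => /malgU_inj ->.
Qed.

Lemma is_mul_functional (x y a b : labelled) : is_mul x a b -> is_mul y a b -> x = y.
Proof.
case: x y => [I x] [J y] [/= /andP[/eqP EI _] xab] [/= /andP[/eqP EJ _] yab].
by subst I J; rewrite xab in yab; rewrite (malgU_inj yab).
Qed.

Lemma decomp_setD (I A B : {set T}) : decomp I A B -> B = I :\: A.
Proof.
case/andP=> /eqP <- dAB; rewrite setDUl setDv set0U; apply/esym/setDidPl.
by rewrite disjoint_sym.
Qed.

Lemma decomp_right (I A B B' : {set T}) : decomp I A B -> decomp I A B' -> B = B'.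
Proof. by move=> /decomp_setD-> /decomp_setD->. Qed.

Lemma is_comul_functional (x a b a' b' : labelled) :
  is_comul x a b -> is_comul x a' b' -> ground a = ground a' -> a = a'.
Proof.
case: x a b a' b' => [I x] [A a] [B b] [A' a'] [B' b'] [/= dI xab] [/= dI' xab'].
rewrite /ground /= => EA; subst A'; have EB := decomp_right dI dI'; subst B'.
by rewrite xab in xab'; have [->] := malgU_inj xab'.
Qed.

Lemma is_mul_assoc (x u a b c : labelled) : is_mul x u c -> is_mul u a b ->
  exists2 v, is_mul x a v & is_mul v b c.
Proof.
case: x u a b c => [I x] [U u] [A a] [B b] [C c] [/= dI xuc] [/= dU uab].
have UE : U = A :|: B by have /andP[/eqP] := dU.
subst U; have [dBC dA] := decompA dU dI; have [_ _ monH _ _ _] := hopfH.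
have [v vE] := linH.1 _ _ _ _ b c dBC; exists (lab v); split=> //=.
have := mul_assoc monH << ((a, b), c) >> dU dI.
by rewrite /tassoc lmapU !tmapU /= uab vE !tensUU xuc => <-.
Qed.

(** One side of coassociativity is a basis tensor, hence nonzero, so neither coproduct on the other
    side can vanish. *)
Lemma is_comul_assoc (x u a b c : labelled) : is_comul x u c -> is_comul u a b ->
  exists2 v, is_comul x a v & is_comul v b c.
Proof.
case: x u a b c => [I x] [U u] [A a] [B b] [C c] [/= dI xuc] [/= dU uab].
have UE : U = A :|: B by have /andP[/eqP] := dU.
subst U; have [dBC dA] := decompA dU dI; have [_ _ _ comonH _ _] := hopfH.
have := comul_assoc comonH << x >> dU dI.
rewrite xuc tmapU uab tensUU lmapU.
have [xav|[a' [v xav]]] := linH.2 _ _ _ _ x dA.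
  by rewrite xav linear0 => /eqP; rewrite (negPf (malgU_neq0 _ _)).
rewrite xav tmapU; have [vbc|[b' [c' vbc]]] := linH.2 _ _ _ _ v dBC.
  by rewrite vbc tensU0 => /eqP; rewrite (negPf (malgU_neq0 _ _)).
rewrite vbc tensUU => /malgU_inj[aE bE cE].
by exists (lab v); split=> //=; rewrite ?aE ?bE ?cE.
Qed.

Lemma is_comul_mul (x a b c d p p' q q' : labelled) :
  is_mul x a b -> decomp (ground x) (ground c) (ground d) ->
  ground p = ground a :&: ground c -> ground p' = ground a :&: ground d ->
  ground q = ground b :&: ground c -> ground q' = ground b :&: ground d ->
  is_comul a p p' -> is_comul b q q' -> is_mul c p q -> is_mul d p' q' ->
  is_comul x c d.
Proof.
have [_ _ _ _ comH _] := hopfH.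
case: x a b c d p p' q q' => [I x] [A a] [B b] [C c] [D d] [P p] [P' p'] [Q q] [Q' q'].
rewrite /ground /= => -[/= dI xab] dI' EP EP' EQ EQ'; subst P P' Q Q'.
move=> [_ /= app] [_ /= bqq] [_ /= cpq] [_ /= dpq]; split=> //=.
rewrite -xab (comul_mul comH _ dI dI') tmapU app bqq tensUU.
by rewrite /tmid lmapU tmapU /= cpq dpq tensUU.
Qed.

(** In the compatibility axiom the coproduct of [x] is a nonzero basis tensor. This forces the
    coproducts of both [a] and [b] to be nonzero, and their pieces give the factors of [c]. *)
Lemma is_comul_of_mul (x a b c d : labelled) : is_mul x a b -> is_comul x c d ->
  exists p q, [/\ is_mul c p q, ground p = ground a :&: ground c
    & ground q = ground b :&: ground c].
Proof.
have [_ _ _ _ comH _] := hopfH.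
case: x a b c d => [I x] [A a] [B b] [C c] [D d] [/= dI xab] [/= dI' xcd].
have [sA sB] := decompS dI; have [sC sD] := decompS dI'.
have dA : decomp A (A :&: C) (A :&: D) by rewrite !(setIC A); apply: decompI dI' sA.
have dB : decomp B (B :&: C) (B :&: D) by rewrite !(setIC B); apply: decompI dI' sB.
have dC := decompI dI sC; have dD := decompI dI sD.
have := comul_mul comH << (a, b) >> dI dI'; rewrite xab xcd tmapU.
have [->|[p [p' ->]]] := linH.2 _ _ _ _ a dA.
  by rewrite tens0l !linear0 => /eqP; rewrite (negPf (malgU_neq0 _ _)).
have [->|[q [q' ->]]] := linH.2 _ _ _ _ b dB.
  by rewrite tensU0 !linear0 => /eqP; rewrite (negPf (malgU_neq0 _ _)).
rewrite tensUU /tmid lmapU tmapU /=.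
have [c' cE] := linH.1 _ _ _ _ p q dC; have [d' dE] := linH.1 _ _ _ _ p' q' dD.
rewrite cE dE tensUU => /malgU_inj[ec _].
by exists (lab p), (lab q); split=> //; split=> //=; rewrite cE ec.
Qed.

Hypotheses (commH : commutative_monoid H) (cocommH : cocommutative_comonoid H).

Lemma is_mul_splitting : splitting ground is_mul.
Proof.
split.
- by move=> x a b [].
- move=> x a b [d xab]; split; first by rewrite decompC.
  by rewrite -xab -(commH _ d) /tswap lmapU.
- exact: is_mul_assoc.
- by have [e _] := hunit_basis T; exists (lab e).
- exact: is_mul_unit.
- move=> x y z /(is_mul_unit y) yzy xzy; exact: is_mul_functional xzy yzy.
Qed.

Lemma is_comul_sym x a b : is_comul x a b -> is_comul x b a.
Proof.
move=> [d xab]; split; first by rewrite decompC.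
by rewrite -(cocommH _ d) xab /tswap lmapU.
Qed.

Lemma is_comul_splitting : splitting ground is_comul.
Proof.
split.
- by move=> x a b [].
- exact: is_comul_sym.
- exact: is_comul_assoc.
- by have [e _] := hunit_basis T; exists (lab e).
- exact: is_comul_unit.
- move=> x y z /(is_comul_unit x) xzx xzy; have [d _] := xzx; have [d' _] := xzy.
  exact: is_comul_functional (is_comul_sym xzx) (is_comul_sym xzy) (decomp_right d d').
Qed.

(** Compatibility for one decomposition used twice: the mixed intersections are empty, so their
    pieces are units. *)
Lemma is_mul_comul x a b : is_mul x a b -> is_comul x a b.
Proof.
move=> xab; have [d _] := xab; have [e _] := hunit_basis T.
have e0 : ground (lab e) = set0 by [].
have dis : ground a :&: ground b = set0 by apply/eqP; have /andP[] := d; rewrite setI_eq0.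
apply: (is_comul_mul (p := a) (p' := lab e) (q := lab e) (q' := b) xab d).
- by rewrite setIid.
- by rewrite dis.
- by rewrite setIC dis.
- by rewrite setIid.
- by apply: is_comul_sym; apply: is_comul_unit.
- exact: is_comul_unit.
- by apply: (split_sym is_mul_splitting); apply: is_mul_unit.
- exact: is_mul_unit.
Qed.

Lemma labelled_bisplitting : bisplitting ground is_mul is_comul.
Proof.
split; [exact: is_mul_splitting | exact: is_comul_splitting
  | exact: is_mul_functional | exact: is_comul_functional | exact: is_mul_comul
  | exact: is_comul_of_mul].
Qed.

End Labelled.
End LinearizedMonoid.

(** * Set compositions *)

Section SetCompositions.
Variable T : finType.
Implicit Types (I P : {set T}) (s : seq {set T}).

Lemma partition_cons I P s :
  pairwise (fun P Q : {set T} => [disjoint P & Q]) (P :: s) ->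
  \bigcup_(Q <- P :: s) Q = I ->
  [/\ decomp I P (I :\: P), pairwise (fun P Q : {set T} => [disjoint P & Q]) s
    & \bigcup_(Q <- s) Q = I :\: P].
Proof.
rewrite /= big_cons => /andP[/allP Ps ds] <-.
have dP : [disjoint \bigcup_(Q <- s) Q & P].
  by apply: bigcup_seq_disjoint => Q /Ps; rewrite disjoint_sym.
have E : (P :|: \bigcup_(Q <- s) Q) :\: P = \bigcup_(Q <- s) Q.
  by rewrite setDUl setDv set0U; apply/setDidPl.
by rewrite E; split=> //; rewrite /decomp eqxx disjoint_sym.
Qed.

Lemma size_set_comp I s : set_comp I s -> (size s <= #|I|)%N.
Proof.
case/and3P; elim: s I => [|P s IH] I //= /andP[P0 s0] ds /eqP sI.
have [d ds' sI'] := partition_cons ds sI.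
have [sP _] := decompS d; rewrite -(cardsID P I) (setIidPr sP).
by rewrite -add1n leq_add ?card_gt0 // (IH _ s0 ds') ?sI'.
Qed.

End SetCompositions.

(** * Iterated products and coproducts of basis elements *)

Section IteratedOperations.
Variables (K : fieldType) (H : hopf_data K).
Hypotheses (hopfH : connected_hopf_monoid H) (linH : linearized H).
Variable T : finType.
Implicit Types (I P : {set T}) (s : seq {set T}).
Local Notation ground := (@ground K H T).
Local Notation is_mul := (@is_mul K H T).
Local Notation is_comul := (@is_comul K H T).

Fixpoint labels s : tbasis H s -> seq (labelled H T) :=
  if s is P :: s' then fun p => lab p.1 :: labels p.2 else fun=> [::].

Lemma ground_labels s (p : tbasis H s) : map ground (labels p) = s.
Proof. by elim: s p => [|P s IH] //= [a p] /=; rewrite IH. Qed.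

Lemma comul_seq_cons P s I (v : {malg K[basis H I]}) :
  comul_seq (P :: s) v =
  tmap idfun (@comul_seq K H T s (I :\: P)) (comul H I P (I :\: P) v).
Proof. by []. Qed.

Lemma mul_seq_cons P s I (t : {malg K[tbasis H (P :: s)]}) :
  mul_seq I t =
  Defs.mul H I P (I :\: P) (tmap idfun (@mul_seq K H T s (I :\: P)) t).
Proof. by []. Qed.

(** The vanishing case also excludes every relational splitting along [s], so that a splitting can
    certify a nonzero coproduct. *)
Lemma comul_seq_basis s I (x : basis H I) :
  pairwise (fun P Q : {set T} => [disjoint P & Q]) s -> \bigcup_(P <- s) P = I ->
  (comul_seq s (<< x >> : {malg K[basis H I]}) = 0 /\
     forall l, map ground l = s -> ~ splits ground is_comul (lab x) l)
  \/ exists2 p, comul_seq s (<< x >> : {malg K[basis H I]}) = << p >>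
       & splits ground is_comul (lab x) (labels p).
Proof.
elim: s I x => [|P s IH] I x.
  rewrite big_nil => _ I0; subst I; have [e [_ ce eE]] := hunit_basis hopfH linH T.
  by right; exists tt => //=; rewrite [x]eE ce scale1r.
move=> ds sI; have [dI ds' sI'] := partition_cons ds sI; rewrite comul_seq_cons.
have [xPE|[a [b xab]]] := linH.2 _ _ _ _ x dI.
  left; rewrite xPE linear0; split=> // -[|[A a] l] //= [EA _] [[B b] [/= d xab] _].
  subst A; have EB := decomp_right dI d; subst B.
  by rewrite xPE in xab; have := malgU_neq0 K (a, b); rewrite -xab eqxx.
rewrite xab tmapU; have [[b0 bl]|[p bp pl]] := IH _ b ds' sI'; [left|right].
  rewrite b0 tensU0; split=> // -[|[A a'] l] //= [EA El] [[B b'] [/= d xab'] b'l].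
  subst A; have EB := decomp_right dI d; subst B.
  by rewrite xab in xab'; have [_ E] := malgU_inj xab'; apply: (bl l El); rewrite E.
by exists (a, p); [rewrite bp tensUU | exists (lab b)].
Qed.

Lemma mul_seq_basis s I (p : tbasis H s) :
  pairwise (fun P Q : {set T} => [disjoint P & Q]) s -> \bigcup_(P <- s) P = I ->
  exists2 y : basis H I, mul_seq I (<< p >> : {malg K[tbasis H s]}) = << y >>
    & splits ground is_mul (lab y) (labels p).
Proof.
elim: s I p => [|P s IH] I p.
  rewrite big_nil => _ I0; subst I; have [e [ue _ _]] := hunit_basis hopfH linH T.
  by exists e => //=; case: p; rewrite mcoeffUU scale1r.
move=> ds sI; have [dI ds' sI'] := partition_cons ds sI; case: p => a p.
rewrite mul_seq_cons; have [b bE bl] := IH _ p ds' sI'.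
have [y yE] := linH.1 _ _ _ _ a b dI.
by exists y; [rewrite tmapU bE tensUU | exists (lab b)].
Qed.

Lemma mul_seq0 s I : mul_seq I (0 : {malg K[tbasis H s]}) = 0.
Proof. by case: s => [|P s] /=; rewrite ?mcoeff0 ?scale0r ?linear0. Qed.

Lemma mul_comul_seq_coef I (x y : basis H I) s : set_comp I s ->
  (mul_seq I (comul_seq s (<< x >> : {malg K[basis H I]})))@_y = (in_C x y s)%:R.
Proof.
move=> scs; rewrite /in_C scs andTb; have /and3P[_ ds /eqP sI] := scs.
have [[-> _]|[p -> _]] := comul_seq_basis x ds sI.
  by rewrite eqxx mul_seq0 mcoeff0.
rewrite malgU_neq0 andTb; have [z -> _] := mul_seq_basis p ds sI.
rewrite mcoeffU; congr (_ *+ nat_of_bool _).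
by apply/eqP/eqP => [->|/malgU_inj].
Qed.

(** Each composition contributes zero or a signed basis element, and the coefficient at [y] selects
    those in [in_C]. *)
Lemma antipode_coef I (x y : basis H I) :
  (antipode (<< x >> : {malg K[basis H I]}))@_y = c_coef x y.
Proof.
rewrite /antipode /c_coef raddf_sum; apply: eq_bigr => k _.
rewrite raddf_sum [RHS]big_mkcond [LHS]big_mkcond; apply: eq_bigr => A _.
case: ifP => [scA|/negbT nscA]; last by rewrite /in_C (negPf nscA).
apply: etrans (mcoeffZ _ _ _) _; rewrite mul_comul_seq_coef //.
by case: (in_C _ _ _); rewrite ?mulr1 ?mulr0.
Qed.

Lemma restrU I (x : basis H I) (a b : labelled H T) :
  is_comul (lab x) a b -> restr x (tag a) = << tagged a >>.
Proof.
case: a b => [A a] [B b] [/= d xab].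
by rewrite /restr /= -(decomp_setD d) xab lmapU.
Qed.

Lemma tens_seq_basis (f : forall P, {malg K[basis H P]}) (l : seq (labelled H T)) :
  (forall a, a \in l -> f (tag a) = << tagged a >>) ->
  exists2 p : tbasis H (map ground l), tens_seq f (map ground l) = << p >>
    & labels p = l.
Proof.
elim: l => [|a l IH] fl; first by exists tt.
have [|p pE pl] := IH; first by move=> b bl; rewrite fl // inE bl orbT.
exists (tagged a, p); last by rewrite /= pl; case: (a).
by rewrite /= pE fl ?mem_head // tensUU.
Qed.

Hypotheses (commH : commutative_monoid H) (cocommH : cocommutative_comonoid H).
Let bisplit := labelled_bisplitting hopfH linH T commH cocommH.
Let sM := mu_splitting bisplit.
Let sC := co_splitting bisplit.

(** One list serves both elements: the tensor factors of [x] along [s] are the factors of [y].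
    Disjointness and covering are recovered from the splitting of [y]. *)
Lemma in_CP I (x y : basis H I) s :
  in_C x y s <->
  all (fun P => P != set0) s /\
  exists l, [/\ map ground l = s, splits ground is_comul (lab x) l
    & splits ground is_mul (lab y) l].
Proof.
split=> [/and3P[/and3P[s0 ds /eqP sI] x0 /eqP xy]|[s0 [l [ls xl yl]]]].
  split=> //; have [[E _]|[p xp pl]] := comul_seq_basis x ds sI.
    by rewrite E eqxx in x0.
  have [z zE zp] := mul_seq_basis p ds sI.
  rewrite xp zE in xy; rewrite (malgU_inj xy) in zp.
  by exists (labels p); rewrite ground_labels.
have ds := splits_pairwise sM yl; rewrite ls in ds.
have sI : \bigcup_(P <- s) P = I by rewrite -ls big_map -(splits_tg sM yl).
have scs : set_comp I s by apply/and3P; split=> //; apply/eqP.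
rewrite /in_C scs andTb.
have [[_ /(_ l ls)]//|[p -> xp]] := comul_seq_basis x ds sI.
rewrite malgU_neq0 andTb; have [z -> zp] := mul_seq_basis p ds sI.
have pl : labels p = l.
  by apply: (splits_co_functional bisplit xp xl); rewrite ground_labels.
by rewrite pl in zp; rewrite (lab_inj (splits_mu_functional bisplit zp yl)).
Qed.

Lemma minimal_irreducible I (x y : basis H I) l :
  splits ground is_comul (lab x) l -> splits ground is_mul (lab y) l ->
  minimal_in_C x y (map ground l) ->
  forall u p q, u \in l -> is_mul u p q -> ground p = set0 \/ ground q = set0.
Proof.
move=> xl yl [inCl minl] u p q ul upq.
have [|p0] := eqVneq (ground p) set0; first by left.
have [|q0] := eqVneq (ground q) set0; first by right.
case/splitPr: ul xl yl inCl minl => l1 l2 xl yl inCl minl.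
have /minl E : in_C x y (map ground (l1 ++ p :: q :: l2)).
  apply/in_CP; split; last first.
    exists (l1 ++ p :: q :: l2); split=> //.
      exact: (splits_refine sC xl (is_mul_comul hopfH linH commH cocommH upq)).
    exact: (splits_refine sM yl upq).
  have /in_CP[+ _] := inCl; rewrite !map_cat !all_cat /= => /and3P[-> _ ->].
  by rewrite p0 q0.
have /E /(congr1 size) : refines (map ground (l1 ++ p :: q :: l2))
    (map ground (l1 ++ u :: l2)).
  (* Every block is a singleton except the one that groups the two factors of [u]; the finer list
     has one more part. *)
  exists ([seq [:: P] | P <- map ground l1] ++ [:: ground p; ground q]
    :: [seq [:: P] | P <- map ground l2]); split.
    by rewrite flatten_cat /= !flatten_seq1 map_cat.
  rewrite !map_cat /= -!map_comp (split_tg sM upq); congr (_ ++ _ :: _).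
  - by apply: eq_map => a /=; rewrite big_seq1.
  - by rewrite big_cons big_seq1.
  - by apply: eq_map => a /=; rewrite big_seq1.
by rewrite !size_map !size_cat /= => /eqP; rewrite eqn_add2l !eqSS (gtn_eqF (ltnSn _)).
Qed.

Section ProductRestriction.
Variables (I : {set T}) (x : basis H I) (m : nat) (L : m.-tuple {set T}).
Variable F : 'I_m -> labelled H T.
Hypotheses (LF : forall i, tnth L i = ground (F i))
  (xF : splits ground is_comul (lab x) (codom F)).

Lemma union_of_region U : union_of L U = region ground F U.
Proof. by apply: eq_bigr => i _; rewrite LF. Qed.

(** With [w] the restriction of [x] to the union and [z] the product of the factors, both sides say
    that [z] and [w] coincide. *)
Lemma prod_eq_restrP U :
  prod_eq_restr x L U <-> product_restr ground is_mul is_comul (lab x) F U.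
Proof.
have [w [v [xwv wU _]]] := (splits_cat sC _ _ _).1 (splits_perm sC (factorsCU F U) xF).
have Ew : ground w = union_of L U.
  by rewrite (splits_tg sC wU) region_factors union_of_region.
have mapF : [seq tnth L i | i <- enum U] = map ground (factors F U).
  by rewrite /factors -map_comp; apply: eq_map => i; rewrite LF.
have [|p pE pl] := @tens_seq_basis (restr x) (factors F U).
  move=> _ /mapP[i _ ->]; have [b xb _] := splits_mem sC xF (codom_f F i).
  exact: restrU xb.
have dF := splits_pairwise sC wU.
have UF : \bigcup_(P <- map ground (factors F U)) P = union_of L U.
  by rewrite big_map region_factors union_of_region.
have [z zE zp] := mul_seq_basis p dF UF; rewrite pl in zp.
rewrite /prod_eq_restr mapF pE zE.
case: w xwv wU Ew => [W w] xwv wU Ew; rewrite /ground /= in Ew; subst W.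
rewrite (restrU xwv) /=; split=> [/eqP/malgU_inj zw|[q qU [r xqr]]].
  by exists (lab z) => //; exists v; rewrite zw.
have qz := splits_mu_functional bisplit qU zp; rewrite {}qz in xqr.
have := is_comul_functional xqr xwv erefl.
by move/lab_inj ->.
Qed.

End ProductRestriction.
End IteratedOperations.

(** * Set compositions acting on hypergraphs *)

Lemma hg_mul_comul_seq (K : fieldType) (T : finType) (s : seq {set T}) (J : {set T})
    (g : hypergraph J) :
  pairwise (fun P Q : {set T} => [disjoint P & Q]) s -> \bigcup_(P <- s) P = J ->
  exists p, comul_seq (H := HG K) s (<< g >> : {malg K[hypergraph J]}) = << p >> /\
    exists2 h : hypergraph J, mul_seq (H := HG K) J << p >> = << h >>
      & val h = [set U in val g | has (fun P : {set T} => U \subset P) s].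
Proof.
elim: s J g => [|P s IH] J g.
  rewrite big_nil => _ J0; subst J; exists tt; split.
    by rewrite /comul_seq hg_hcounitU eqxx scale1r.
  exists (hg_empty set0); last by apply/setP => U; rewrite !inE andbF.
  by rewrite /mul_seq mcoeffUU scale1r hg_hunit.
move=> ds sJ; have [dJ ds' sJ'] := partition_cons ds sJ.
have [p [pE [h hE hV]]] := IH _ (hg_restr (J :\: P) g) ds' sJ'.
exists (hg_restr P g, p); split.
  by rewrite comul_seq_cons hg_comulU tmapU pE tensUU.
rewrite mul_seq_cons tmapU hE tensUU.
have [k kE kV] := hg_mulU K (hg_restr P g) h dJ; exists k; first exact: kE.
rewrite kV hV; apply/setP => U; rewrite !inE /= -andbA -andb_orr; congr (_ && _).
(* An edge inside a later part [Q] already lies in [J :\: P]. *)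
congr (_ || _); case: hasP => [[Q sQ UQ]|]; rewrite ?andbF ?andbT //.
by rewrite -sJ' (subset_trans UQ) // (bigcup_seq_sup (fun P => P)).
Qed.

(** Coproducts of hypergraphs never vanish, and the edges that survive are those inside some
    part. *)
Lemma hg_in_C (K : fieldType) (m : nat) (G : hypergraph [set: 'I_m]) s :
  in_C (H := HG K) G (hg_empty [set: 'I_m]) s =
  set_comp [set: 'I_m] s &&
  all (fun V : {set 'I_m} => ~~ [exists U in val G, U \subset V]) s.
Proof.
rewrite /in_C; case: (boolP (set_comp _ s)) => // /and3P[_ ds /eqP sT].
have [p [-> [h -> hV]]] := hg_mul_comul_seq K G ds sT.
rewrite malgU_neq0 !andTb; apply/eqP/allP => [/malgU_inj hE V sV|Gs].
  apply/exists_inP => -[U GU UV]; have : U \in val h.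
    by rewrite hV inE GU; apply/hasP; exists V.
  by rewrite hE inE.
apply: hg_eq; rewrite hV; apply/setP => U; rewrite !inE; apply/negP.
case/andP=> GU /hasP[V sV UV]; have /negP := Gs V sV; apply.
by apply/exists_inP; exists U.
Qed.

(** * Signed counts by length *)

Section Counting.
Variables (K : fieldType) (H : hopf_data K) (T : finType) (I : {set T}).

(** Lengths above [#|I|] contribute nothing. A free bound lets sums over different ground sets share
    one index range. *)
Lemma c_coef_widen (x y : basis H I) n : (#|I| < n)%N ->
  c_coef x y = \sum_(k < n) (-1) ^+ k *+ #|[set A : k.-tuple {set T} | in_C x y A]|.
Proof.
move=> In; pose F k : K := (-1) ^+ k *+ #|[set A : k.-tuple {set T} | in_C x y A]|.
transitivity (\sum_(k < #|I|.+1) F k).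
  by apply: eq_bigr => k _; rewrite sumr_const /F cardsE.
rewrite (big_ord_widen _ F In) big_mkcond; apply: eq_bigr => k _; case: ifP => // kI.
rewrite -/(F k) /F (_ : [set A : k.-tuple {set T} | in_C x y A] = set0) ?cards0 //.
apply/setP => A; rewrite !inE; apply/negP => /and3P[/size_set_comp + _ _].
by rewrite size_tuple -ltnS kI.
Qed.

End Counting.

(** * Comparison with the hypergraph *)

Unset Implicit Arguments.

Theorem theorem3p7 (K : fieldType) (char0 : [pchar K] =i pred0)
  (H : hopf_data K) (hopfH : connected_hopf_monoid H)
  (commH : commutative_monoid H) (cocommH : cocommutative_comonoid H)
  (linH : linearized H)
  (T : finType) (I : {set T}) (x y : basis H I)
  (C_neq0 : exists A : seq {set T}, in_C x y A)
  (m : nat) (L : m.-tuple {set T}) (minL : minimal_in_C x y L) :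
  c_coef x y = (antipode (<< x >> : {malg K[basis H I]}))@_y
  /\
  exists G : hypergraph [set: 'I_m],
    (forall U : {set 'I_m}, U \in val G <-> is_hyperedge x L U)
    /\
    c_coef x y =
      (antipode (H := HG K) (<< G >> : {malg K[hypergraph [set: 'I_m]]}))
        @_(hg_empty [set: 'I_m]).
Proof.
split; first by rewrite antipode_coef.
pose B := labelled_bisplitting hopfH linH T commH cocommH.
have inCP := in_CP hopfH linH commH cocommH x y.
have [L0 [l [lL xl yl]]] := (inCP L).1 minL.1.
have szl : size l == m by rewrite -(size_map (@ground K H T)) lL size_tuple.
(* [F i] is the piece of [x] on part [i] of [L]; these pieces multiply to [y]. *)
pose F := tnth (Tuple szl).
have codomF : codom F = l by rewrite /codom /image_mem map_tnth_enum.
have LF i : tnth L i = ground (F i).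
  rewrite (tnth_nth set0) -lL (nth_map (F i)) ?(eqP szl) //.
  by congr ground; rewrite {2}/F (tnth_nth (F i)).
have F0 i : ground (F i) != set0 by rewrite -LF (allP L0) ?mem_tnth.
have Firr i p q : is_mul (F i) p q -> ground p = set0 \/ ground q = set0.
  apply: (minimal_irreducible hopfH linH commH cocommH xl yl); last exact: mem_tnth.
  by rewrite lL.
rewrite -codomF in xl yl.
pose region := region (@ground K H T) F.
have prodP := prod_eq_restrP hopfH linH commH cocommH LF xl.
(* A boolean form of [is_hyperedge], from which the edge set can be formed. *)
pose bad_min (U : {set 'I_m}) := ~~ prod_eq_restr x L U &&
  [forall P : {set 'I_m}, (P != set0) && (P \proper U) ==> prod_eq_restr x L P].
have bad_minP U : reflect (is_hyperedge x L U) (bad_min U).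
  apply: (iffP andP) => -[bU minU]; split=> //.
    by move=> P P0 PU; have /forallP/(_ P) := minU; rewrite P0 PU.
  by apply/forallP => P; apply/implyP => /andP[]; apply: minU.
(* Edges have at least two vertices because products over the empty set and over singletons are
   restrictions of [x]. *)
have bad_hg : hypergraph_on [set: 'I_m] [set U | bad_min U].
  apply/forall_inP => U; rewrite inE subsetT andbT => /andP[bU _].
  rewrite ltnNge; apply: contra bU; rewrite leq_eqVlt ltnS leqn0 => U1.
  apply/prodP; case/orP: U1 => [/cards1P[i ->]|]; first exact: (product_restr1 B xl).
  by rewrite cards_eq0 => /eqP->; apply: (product_restr0 B).
pose G : hypergraph [set: 'I_m] := exist (fun k => hypergraph_on _ k) _ bad_hg.
(* The condition passes to subsets, and a violator contains an inclusion-minimal one, which is an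
   edge. *)
have GE V : prod_eq_restr x L V = ~~ [exists U in val G, U \subset V].
  apply/idP/idP => [gV|]; last apply: contraNT => bV.
    apply/exists_inP => -[U]; rewrite /= inE => /andP[/negP bU _] UV; apply: bU.
    by apply/prodP/(product_restr_sub B UV)/prodP.
  have [U /minsetP[bU minU] UV] :=
    minset_exists (P := [pred U | ~~ prod_eq_restr x L U]) bV.
  apply/exists_inP; exists U => //; rewrite /= inE; apply/andP; split=> //.
  apply/forallP => P; apply/implyP => /andP[_ PU]; apply: contraT => bP.
  by have := minU P bP (proper_sub PU) => E; rewrite E properxx in PU.
exists G; split=> [U|]; first by rewrite /= inE; split=> /bad_minP.
rewrite (antipode_coef (HG_hopf_monoid K) (HG_linearized K)).
(* [L] has [m] nonempty disjoint parts in [I], so both sums can run over lengths up to [#|I|]. *)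
have mI : (#|[set: 'I_m]| < #|I|.+1)%N.
  rewrite cardsT card_ord ltnS -(size_tuple L).
  by apply: size_set_comp; have /and3P[] := minL.1.
rewrite (c_coef_widen x y (ltnSn _)) (c_coef_widen (H := HG K) _ _ mI).
apply: eq_bigr => k _; congr (_ *+ _).
have inCE s : in_C x y (map region s) =
    in_C (H := HG K) G (hg_empty [set: 'I_m]) s.
  rewrite hg_in_C; apply/idP/andP => [xys|[sT Gs]].
    have sT : set_comp [set: 'I_m] s.
      by rewrite -(set_comp_region B xl yl F0); case/and3P: xys.
    split=> //; apply/allP => V sV; rewrite -GE; apply/prodP.
    have [_ [l' [l'E xl' yl']]] := (inCP _).1 xys.
    by move: V sV; apply/(product_restr_splits B xl yl sT); exists l'.
  have /(product_restr_splits B xl yl sT) [l' [l'E xl' yl']] : forall V, V \in s ->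
      product_restr (@ground K H T) (@is_mul K H T) (@is_comul K H T) (lab x) F V.
    by move=> V sV; apply/prodP; rewrite GE (allP Gs).
  apply/inCP; split; last by exists l'.
  by have := sT; rewrite -(set_comp_region B xl yl F0) => /and3P[].
(* At each length [f] matches the two families of compositions; surjectivity is [splits_region],
   where irreducibility of the factors enters. *)
pose f (a : k.-tuple {set 'I_m}) := map_tuple region a.
have f_inj : injective f.
  move=> a b /(congr1 val) /= /(inj_map (region_inj B xl F0)); exact: val_inj.
rewrite -[RHS](card_imset _ f_inj); apply: eq_card => A; rewrite inE.
apply/idP/imsetP => [xyA|[a]]; last by rewrite inE -inCE => xya ->.
have [_ [l' [l'E _ yl']]] := (inCP _).1 xyA.
have [s sE] := splits_region B yl Firr yl'.
have szs : size s == k by rewrite -(size_map region) -sE l'E size_tuple.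
have AE : A = f (Tuple szs) by apply: val_inj; rewrite /= -l'E sE.
by exists (Tuple szs); rewrite // inE -inCE; move: xyA; rewrite AE.
Qed.
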